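(* Let $f:\mathbb{R}^-\to\mathbb{R}$ be a $C^3$ function on the negative real line defining a statistical perfect fluid, with generating function $$\chi_{\rm eq}(\zeta,\zeta^a)=\int f(\zeta+p_a\zeta^a)\,d\omega ,$$ such that this equilibrium theory is well defined. If the equilibrium theory is manifestly causal, i.e. $f'''>0$ on $\mathbb{R}^-$, then the extended dissipative theory, i.e. the divergence type theory whose generating function $\chi(\zeta,\zeta^a,\zeta^{ab})$ is equal to $$\int f(\zeta+p_a\zeta^a+p_ap_b\zeta^{ab})\,d\omega \qquad\text{for } \zeta^{ab}\in C^-$$ and is any smooth extension of this expression to the remaining values of $\zeta^{ab}$ in a neighborhood of equilibrium, is causal in a neighborhood of equilibrium: every equilibrium state $(\zeta,\zeta^a,0)$ has a neighborhood, in the space of states $(\zeta,\zeta^a,\zeta^{ab})$, at every point of which the theory is causal.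
   Context: Setting. Work on (the tangent space at a point of) a 4-dimensional time-oriented Lorentzian spacetime with metric $g_{ab}$ of signature $(-,+,+,+)$; indices are raised and lowered with $g_{ab}$. Fix a mass $m>0$. All integrals $\int\cdots d\omega$ are over the future mass shell $\{p_a \text{ future-directed}: p^ap_a=-m^2\}$ with respect to its Lorentz-invariant volume element $d\omega$. States. The dynamical variables (states) are $\zeta^A=(\zeta,\zeta^a,\zeta^{ab})$ with $\zeta<0$ a real number, $\zeta^a$ a future-directed timelike vector, and $\zeta^{ab}$ a symmetric trace-free ($g_{ab}\zeta^{ab}=0$) tensor. Thus $\zeta+p_a\zeta^a<0$ for every $p_a$ in the future mass shell. Equilibrium states are those with $\zeta^{ab}=0$. Divergence type theory. A theory is determined by a scalar generating function $\chi(\zeta,\zeta^a,\zeta^{ab})$ together with a dissipation-source tensor $I^{ab}$; the field equations are $\nabla_aN^a=0$, $\nabla_aT^{ab}=0$, $\nabla_aA^{abc}=I^{bc}$ with $$N_a=\frac{\partial^2\chi}{\partial\zeta\,\partial\zeta^a},\quad T_{ab}=\frac{\partial^2\chi}{\partial\zeta^a\partial\zeta^b},\quad A_{abc}=\frac{\partial^2\chi}{\partial\zeta^a\partial\zeta^{bc}} .$$ Equivalently $M^a_{AB}\nabla_a\zeta^B=I_A$, where $I_A=(0,0,I_{ab})$ and $M^a_{AB}=\dfrac{\partial^3\chi}{\partial\zeta_a\,\partial\zeta^A\,\partial\zeta^B}$. (Derivatives with respect to $\zeta^{ab}$ are along symmetric trace-free tensors.) Causality. The theory is causal at a state if for every nonzero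 perturbation $Z^A=(\delta\zeta,\delta\zeta^a,\delta\zeta^{ab})$ (with $\delta\zeta^{ab}$ symmetric and trace-free) the vector $E^a=\tfrac12 M^a_{AB}Z^AZ^B$, with $M^a_{AB}$ evaluated at that state, is future-directed timelike; the condition is expressed as $t_aE^a<0$ for all future-directed timelike $t_a$. Statistical perfect fluid. A perfect fluid theory (generating function depending only on $(\zeta,\zeta^a)$, and $I^{ab}=0$) is of statistical type if its generating function is $\chi_{\rm eq}(\zeta,\zeta^a)=\int f(\zeta+p_a\zeta^a)\,d\omega$, where $f$ is a scalar function on the negative real line which for large negative values decays fast enough to make the integral well defined and the generating function smooth in all its variables (''the equilibrium theory is well defined''). The cone. $C^-=\{\zeta^{ab}\;:\;\zeta^{ab}=\zeta^{ba},\ g_{ab}\zeta^{ab}=0,\ l_al_b\zeta^{ab}\le 0 \text{ for all null } l_a\}$. For $\zeta^{ab}\in C^-$ the argument $\zeta+p_a\zeta^a+p_ap_b\zeta^{ab}$ is negative for all $p_a$ in the future mass shell. Extended dissipative theory. Its generating function is $\int f(\zeta+p_a\zeta^a+p_ap_b\zeta^{ab})\,d\omega$ for $\zeta^{ab}\in C^-$. It is a standing assumption that this function has been extended smoothly, in an otherwise arbitrary way, to values of $\zeta^{ab}\notin C^-$, so that $\chi$ is smooth in a neighborhood of the equilibrium states. *)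

(* Defs.v *)
From HB Require Import structures.
From mathcomp Require Import all_boot all_order all_algebra.
From mathcomp Require Import all_classical all_reals all_analysis.

Set Implicit Arguments.
Unset Strict Implicit.
Unset Printing Implicit Defensive.

Import Order.TTheory GRing.Theory Num.Theory.
Import numFieldNormedType.Exports.

Local Open Scope classical_set_scope.
Local Open Scope ring_scope.

(* Tangent space in a time-oriented orthonormal frame: a vector [v] has
   contravariant components [v 0 a], and index [0] is the time direction.
   A covector [p_a] is represented by the vector [p^a]. *)
Section Minkowski.
Variable R : realType.
Implicit Types (u v p : 'rV[R]_4) (S : 'M[R]_4).

Definition eta : 'M[R]_4 :=
  \matrix_(a, b) (if a == b then (if a == 0 then -1 else 1) else 0).

Definition lower v : 'rV[R]_4 := v *m eta.

Definition dot u v : R := \sum_a lower u 0 a * v 0 a.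

Definition dot2 p S : R := \sum_a \sum_b lower p 0 a * lower p 0 b * S a b.

Definition future_timelike v : Prop := dot v v < 0 /\ 0 < v 0 0.

Definition null v : Prop := dot v v = 0.

Definition tracefree_sym S : Prop :=
  S^T = S /\ \sum_a \sum_b eta a b * S a b = 0.

Definition Cminus S : Prop :=
  tracefree_sym S /\ forall l, null l -> dot2 l S <= 0.

End Minkowski.

(* The future mass shell is the graph p^0 = sqrt (m^2 + |k|^2) over the spatial
   momentum k in R^3; its induced volume element is (m / p^0) d^3k.  Any other
   Lorentz-invariant normalisation is a positive multiple of this one. *)
Section MassShell.
Variables (R : realType) (m : R).

Definition energy (k : R * R * R) : R :=
  Num.sqrt (m ^+ 2 + k.1.1 ^+ 2 + k.1.2 ^+ 2 + k.2 ^+ 2).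

Definition shell (k : R * R * R) : 'rV[R]_4 :=
  \row_a nth 0 [:: energy k; k.1.1; k.1.2; k.2] a.

Definition leb3 :=
  ((@lebesgue_measure R \x @lebesgue_measure R) \x @lebesgue_measure R)%E.

Definition shell_density (F : 'rV[R]_4 -> R) (k : R * R * R) : R :=
  F (shell k) * (m / energy k).

Definition shell_integrable (F : 'rV[R]_4 -> R) : Prop :=
  leb3.-integrable setT (EFin \o shell_density F).

Definition shell_integral (F : 'rV[R]_4 -> R) : R :=
  Rintegral leb3 setT (shell_density F).

End MassShell.

(* [F] is C^k on [U], where [U] is a relatively open subset of the linear
   subspace [W] of [V]: only derivatives along [W] are taken, and continuity is
   relative to [U], so the values of [F] off [W] play no role. *)
Fixpoint Ck_on (R : realType) (V : normedModType R) (W : set V) (k : nat)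
    (U : set V) (F : V -> R) : Prop :=
  {within U, continuous F} /\
  match k with
  | 0 => True
  | k'.+1 => forall v, W v ->
      (forall x, U x -> derivable F x v) /\ Ck_on W k' U ('D_v F)
  end.

(* The triples (zeta, zeta^a, zeta^ab).  The last component ranges over all
   matrices; the linear space of variables of the theory is [perturbation]. *)
Notation dynvar R := (R * 'rV[R]_4 * 'M[R]_4)%type.

Section Theory.
Variable R : realType.

Definition perturbation : set (dynvar R) :=
  [set Z | tracefree_sym Z.2].

Definition eq_state : set (R * 'rV[R]_4) :=
  [set x | x.1 < 0 /\ future_timelike x.2].

Definition state : set (dynvar R) :=
  [set x | eq_state x.1 /\ tracefree_sym x.2].

Definition d_vec (a : 'I_4) : dynvar R := (0, delta_mx 0 a, 0).

(* M^a_{AB} Z^A Y^B, where M^a_{AB} is the third derivative of chi with respect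
   to zeta_a, zeta^A, zeta^B.  As eta is its own inverse, [lower] also raises
   the index of d/d zeta^a. *)
Definition Mform (chi : dynvar R -> R)
    (x Z Y : dynvar R) : 'rV[R]_4 :=
  lower (\row_a 'D_(d_vec a) ('D_Z ('D_Y chi)) x).

(* The dissipation source I^{ab} does not enter the principal part M, hence
   causality is a property of the generating function alone. *)
Definition causal_at (chi : dynvar R -> R)
    (x : dynvar R) : Prop :=
  forall Z, perturbation Z -> Z != 0 ->
    future_timelike (2^-1 *: Mform chi x Z Z).

Definition chi_eq (m : R) (f : R -> R) (x : R * 'rV[R]_4) : R :=
  shell_integral m (fun p => f (x.1 + dot p x.2)).

(* Here and in [extended_dissipative], "smooth" is required only up to order 3,
   the order of the derivatives in [Mform] and the regularity of f; C^oo
   generating functions are a special case. *)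
Definition equilibrium_well_defined (m : R) (f : R -> R) : Prop :=
  (forall x, eq_state x ->
     shell_integrable m (fun p => f (x.1 + dot p x.2))) /\
  Ck_on setT 3 eq_state (chi_eq m f).

Definition manifestly_causal (f : R -> R) : Prop :=
  forall x : R, x < 0 -> 0 < (f^`(3))%classic x.

Definition extended_dissipative (m : R) (f : R -> R)
    (chi : dynvar R -> R) : Prop :=
  (forall x, state x -> Cminus x.2 ->
     chi x = shell_integral m
               (fun p => f (x.1.1 + dot p x.1.2 + dot2 p x.2))) /\
  exists O : set (dynvar R),
    [/\ open O, forall x, eq_state x -> O (x, 0)
      & Ck_on perturbation 3 (O `&` state) chi].

End Theory.

(* Main.v *)
Require Import Defs.
From mathcomp Require Import all_boot all_order all_algebra.
From mathcomp Require Import all_classical all_reals all_analysis.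
From mathcomp Require Import measurable_realfun ring lra.
Import Order.TTheory GRing.Theory Num.Theory.
Import numFieldNormedType.Exports.
Local Open Scope classical_set_scope.
Local Open Scope ring_scope.

Set Implicit Arguments.
Unset Strict Implicit.
Unset Printing Implicit Defensive.

(* At an equilibrium state the third derivatives of chi are limits of third
   differences taken at base points pushed slightly into C^- along its axis
   -diag(3,1,1,1); there chi is the integral, so each third difference is the
   integral over the shell of the third difference of f, that is, of
   h^3 f'''(xi) (p.t) (p.Z)^2.  For t causal this integrand has a fixed sign,
   hence a bound on a small cube of momenta where p.Z <> 0 bounds the third
   derivative away from 0, without differentiating under the integral sign.
   Integrability on C^- follows from integrability at equilibrium: since f is
   not bounded away from 0 at -oo and f''' > 0, successively f'', f' and f are
   positive, so f is increasing, and p.p.zeta <= 0 only decreases its argument.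
   Causality near equilibrium then follows by trilinearity, continuity and
   compactness of the unit sphere of perturbations. *)

(** * Directional derivatives relative to a subspace *)

(** Equilibrium sits at the apex of [Cminus], and off the cone [chi] is an arbitrary extension, so
    an increment of [chi] at equilibrium in a general direction is not an integral. Its third
    derivatives there are nevertheless determined: the cone has interior relative to the trace-free
    symmetric tensors, and the derivatives are continuous up to the apex. Finite differences are
    forced by the hypotheses, which give integrability of f along equilibrium states but no
    integrable bound on f', f'' or f'''; a third difference involves six values of f and nothing
    else. A second obstacle is that [Ck_on] speaks of derivatives in one direction at a time, along
    a subspace. Linearity in the direction, needed to reduce all perturbations to finitely many
    continuous coefficients, must be recovered from continuity of the derivatives. The constraint of
    symmetry and zero trace is handled by a redundant spanning family of perturbations instead of a
    basis. *)

Section DirectionalDerivatives.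
Variables (R : realType) (V : normedModType R).
Implicit Types (F G : V -> R) (x v w : V) (A : set V).

Lemma nbhs_norm_le {x A} : nbhs x A ->
  exists2 e : R, 0 < e & forall z, `|z| <= e -> A (x + z).
Proof.
move=> /nbhs_ballP[e /= e0 eA]; exists (e / 2); first by rewrite divr_gt0.
move=> z ze; apply: eA; rewrite -ball_normE /ball_ /=.
by rewrite opprD addrA subrr sub0r normrN (le_lt_trans ze)// ltr_pdivrMr// ltr_pMr// ltr1n.
Qed.

Lemma line_quotient F x v (s : R) :
  (fun h : R => h^-1 *: (((fun t : R => F (x + t *: v)) \o shift s) (h *: 1)
     - F (x + s *: v))) =
  (fun h : R => h^-1 *: ((F \o shift (x + s *: v)) (h *: v) - F (x + s *: v))).
Proof.
apply/funext => h /=; congr (_ *: (F _ - _)).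
by rewrite scalerDl /= addrCA; congr (_ + _); rewrite /GRing.scale /= mulr1.
Qed.

Lemma is_derive_line F x v (s d : R) : is_derive (x + s *: v) v F d ->
  is_derive s 1 (fun t : R => F (x + t *: v)) d.
Proof.
move=> [dF vF]; split.
  by rewrite /derivable line_quotient.
by rewrite -vF /derive line_quotient.
Qed.

Lemma MVT_line F G x v (h : R) : 0 < h ->
  (forall s, 0 <= s <= h -> is_derive (x + s *: v) v F (G (x + s *: v))) ->
  exists2 s, 0 <= s <= h & F (x + h *: v) - F x = h * G (x + s *: v).
Proof.
move=> h0 dF.
have dL s : 0 <= s <= h ->
    is_derive s (1 : R) (fun t : R => F (x + t *: v)) (G (x + s *: v)).
  by move=> sh; apply: is_derive_line; exact: dF.
have [||c cab /= E] := @MVT _ (fun t : R => F (x + t *: v)) (fun s => G (x + s *: v)) 0 h h0.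
- by move=> s; rewrite in_itv /= => /andP[s0 sh]; apply: dL; rewrite !ltW.
- apply: derivable_within_continuous => s; rewrite in_itv /= => sh.
  exact: (@ex_derive _ _ _ _ _ _ _ (dL s sh)).
exists c; first by move: cab; rewrite in_itv /= => /andP[? ?]; rewrite !ltW.
by move: E; rewrite scale0r addr0 subr0 mulrC.
Qed.

(* The two steps along [v] are peeled off first, so that the derivatives appear
   in the order [D_w (D_v (D_v F))] of [Mform]: no symmetry of higher
   derivatives is needed. *)
Lemma third_difference F0 F1 F2 F3 x v w (h : R) : 0 < h ->
  (forall s r, 0 <= s <= 2 * h -> 0 <= r <= h -> let y := x + s *: v + r *: w in
    [/\ is_derive y v F0 (F1 y), is_derive y v F1 (F2 y)
      & is_derive y w F2 (F3 y)]) ->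
  exists s r, [/\ 0 <= s <= 2 * h, 0 <= r <= h &
    (F0 (x + (2 * h) *: v + h *: w) - 2 * F0 (x + h *: v + h *: w) + F0 (x + h *: w))
    - (F0 (x + (2 * h) *: v) - 2 * F0 (x + h *: v) + F0 x)
    = h ^+ 3 * F3 (x + s *: v + r *: w)].
Proof.
move=> h0 dF.
have dF' y s r : 0 <= s <= 2 * h -> 0 <= r <= h -> y = x + s *: v + r *: w ->
    [/\ is_derive y v F0 (F1 y), is_derive y v F1 (F2 y)
      & is_derive y w F2 (F3 y)].
  by move=> ? ? ->; exact: dF.
have hh : h *: v + h *: v = (2 * h) *: v by rewrite -scalerDl; congr (_ *: _); ring.
pose D0 y := (F0 (y + h *: v + h *: w) - F0 (y + h *: w)) - (F0 (y + h *: v) - F0 y).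
pose D1 y := (F1 (y + h *: v + h *: w) - F1 (y + h *: w)) - (F1 (y + h *: v) - F1 y).
have der_shift (Fa Fb : V -> R) z y u : is_derive (y + z) u Fa (Fb (y + z)) ->
    is_derive y u (fun y => Fa (y + z)) (Fb (y + z)).
  move=> [d1 d2].
  have E : (fun h : R => h^-1 *: (((fun y => Fa (y + z)) \o shift y) (h *: u) - Fa (y + z)))
    = (fun h : R => h^-1 *: ((Fa \o shift (y + z)) (h *: u) - Fa (y + z))).
    by apply/funext => k /=; rewrite addrA.
  by split; [rewrite /derivable E | rewrite -d2 /derive E].
have dB y u (Fa Fb : V -> R) a b : is_derive y u Fa a -> is_derive y u Fb b ->
    is_derive y u (fun z => Fa z - Fb z) (a - b) by move=> ? ?; exact: is_deriveB.
(* Three mean value steps, each giving one factor [h]: [D0] along [v], then the [w]-difference of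
   [F1] along [v], then [F2] along [w]. The two parameters along [v] add up, whence the range up to
   [2 * h]. *)
have [s s_h E1] : exists2 s, 0 <= s <= h & D0 (x + h *: v) - D0 x = h * D1 (x + s *: v).
  apply: MVT_line => // s /andP[s0 sh].
  have b2 : 0 <= h + s <= 2 * h by lra.
  have b1 : 0 <= s <= 2 * h by lra.
  have r0 : 0 <= (0 : R) <= h by lra.
  have r1 : 0 <= h <= h by lra.
  have [dA _ _] := dF' (x + s *: v + (h *: v + h *: w)) _ _ b2 r1
    ltac:(by rewrite scalerDl !addrA (addrAC x)).
  have [dB1 _ _] := dF' (x + s *: v + h *: w) _ _ b1 r1 erefl.
  have [dC _ _] := dF' (x + s *: v + h *: v) _ _ b2 r0
    ltac:(by rewrite scale0r addr0 scalerDl addrA addrAC).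
  have [dD _ _] := dF' (x + s *: v) _ _ b1 r0 ltac:(by rewrite scale0r addr0).
  have dA' : is_derive (x + s *: v) v (fun y => F0 (y + h *: v + h *: w))
      (F1 (x + s *: v + h *: v + h *: w)).
    under eq_fun do rewrite -addrA; rewrite -[x + _ + _ + _]addrA; exact: der_shift.
  rewrite /D0 /D1; apply: dB; apply: dB => //; exact: der_shift.
pose D2 y := F2 (y + h *: w) - F2 y.
have [s' s'_h E2] : exists2 s', 0 <= s' <= h &
   (F1 (x + s *: v + h *: v + h *: w) - F1 (x + s *: v + h *: v))
   - (F1 (x + s *: v + h *: w) - F1 (x + s *: v)) = h * D2 (x + s *: v + s' *: v).
  have [||s' s'_h E] := @MVT_line (fun y => F1 (y + h *: w) - F1 y) D2 (x + s *: v) v h => //.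
  - move=> s' /andP[s'0 s'h]; case/andP: s_h => s0 sh.
    have b : 0 <= s + s' <= 2 * h by lra.
    have r0 : 0 <= (0 : R) <= h by lra.
    have r1 : 0 <= h <= h by lra.
    have [_ dA _] := dF' (x + s *: v + s' *: v + h *: w) _ _ b r1
      ltac:(by rewrite scalerDl addrA).
    have [_ dB1 _] := dF' (x + s *: v + s' *: v) _ _ b r0
      ltac:(by rewrite scale0r addr0 scalerDl addrA).
    rewrite /D2; apply: dB => //; exact: der_shift.
  by exists s'.
have [r r_h E3] : exists2 r, 0 <= r <= h &
    F2 (x + s *: v + s' *: v + h *: w) - F2 (x + s *: v + s' *: v)
    = h * F3 (x + s *: v + s' *: v + r *: w).
  apply: MVT_line => // r r_h; case/andP: s_h => s0 sh; case/andP: s'_h => s'0 s'h.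
  have b : 0 <= s + s' <= 2 * h by lra.
  have [_ _ dA] := dF' (x + s *: v + s' *: v + r *: w) _ _ b r_h
      ltac:(by rewrite scalerDl addrA).
  exact: dA.
exists (s + s'), r; split => //.
  by case/andP: s_h => s0 sh; case/andP: s'_h => s'0 s'h; lra.
rewrite scalerDl addrA -hh !addrA.
move: E1 E2 E3; rewrite /D0 /D1 /D2 => E1 E2 E3.
rewrite exprSr expr2 -!mulrA -E3 -E2.
transitivity (F0 (x + h *: v + h *: v + h *: w) - F0 (x + h *: v + h *: w) -
     (F0 (x + h *: v + h *: v) - F0 (x + h *: v)) -
     (F0 (x + h *: v + h *: w) - F0 (x + h *: w) - (F0 (x + h *: v) - F0 x))); first by ring.
rewrite E1; congr (_ * _); ring.
Qed.

End DirectionalDerivatives.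

Lemma is_deriveZdir (R : realType) (V : normedModType R) (F : V -> R) (x v : V) (a d : R) :
  is_derive x v F d -> is_derive x (a *: v) F (a * d).
Proof.
move=> [dF vF]; have [->|a0] := eqVneq a 0.
  by rewrite scale0r mul0r; exact: is_derive0.
suff L : h^-1 *: ((F \o shift x) (h *: (a *: v)) - F x) @[h --> (0 : R)^'] --> a * d.
  by split; [exact: cvgP L | rewrite /derive; exact: cvg_lim].
have -> : (fun h : R => h^-1 *: ((F \o shift x) (h *: (a *: v)) - F x)) =
    (fun k => a * (k^-1 *: ((F \o shift x) (k *: v) - F x))) \o (fun h => h * a).
  apply/funext => h /=; rewrite scalerA invfM /GRing.scale /= !mulrA.
  by rewrite [a * h^-1]mulrC mulfK.
apply: (@cvg_comp _ _ _ (fun h : R => h * a)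
  (fun k => a * (k^-1 *: ((F \o shift x) (k *: v) - F x))) _ (0 : R)^').
  move=> A [e /= e0 eA]; exists (e / `|a|) => /=; first by rewrite divr_gt0 ?normr_gt0.
  move=> h /=; rewrite sub0r normrN ltr_pdivlMr ?normr_gt0// => he h0.
  by apply: eA; [rewrite /= sub0r normrN normrM | rewrite mulf_neq0].
by apply: cvgZr; rewrite -vF; exact: dF.
Qed.

(** * Linearity in the direction on a relatively open part of a subspace *)

Section RelativelyOpen.
Variables (R : realType) (V : normedModType R) (W N : set V).
Hypothesis W0 : W 0.
Hypothesis WD : forall u v, W u -> W v -> W (u + v).
Hypothesis WZ : forall (a : R) u, W u -> W (a *: u).
Hypothesis Nopen : open N.
Let U := N `&` W.
Implicit Types (F G : V -> R) (x v w : V).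

Lemma relopen_plane x v w : U x -> W v -> W w ->
  exists2 e : R, 0 < e & forall a b, `|a| <= e -> `|b| <= e -> U (x + a *: v + b *: w).
Proof.
move=> [Nx Wx] Wv Ww.
have [e e0 eN] := nbhs_norm_le (open_nbhs_nbhs (conj Nopen Nx)).
have D0 : 0 < 1 + `|v| + `|w| by rewrite -addrA ltr_pwDl// addr_ge0.
exists (e / (1 + `|v| + `|w|)); first by rewrite divr_gt0.
move=> a b ae be; split; last by apply: WD; [apply: WD|]; try exact: WZ.
rewrite -addrA; apply: eN; rewrite (le_trans (ler_normD _ _))// !normrZ.
set c := e / _ in ae be; have c0 : 0 < c by rewrite divr_gt0.
rewrite (@le_trans _ _ (c * `|v| + c * `|w|))//.
  by apply: lerD; apply: ler_wpM2r.
by rewrite -mulrDr /c -mulrA ler_piMr ?(ltW e0)// mulrC ler_pdivrMr// mul1r -addrA lerDr.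
Qed.

(** A line through a point of [U] with direction in [W] stays in [U] for small parameters, so a
    derivative along [W] does not see values off [U]. This allows identities known only on [U] to be
    differentiated. *)
Lemma is_derive_eq_on F G x v d : U x -> W v -> {in U, F =1 G} ->
  is_derive x v F d -> is_derive x v G d.
Proof.
move=> Ux Wv FG [dF vF].
have [e e0 eU] := relopen_plane Ux Wv W0.
have E : \forall h \near (0 : R)^',
   h^-1 *: ((F \o shift x) (h *: v) - F x) = h^-1 *: ((G \o shift x) (h *: v) - G x).
  exists e => // h /=; rewrite sub0r normrN => /ltW he _.
  rewrite /= !FG ?inE//.
  have := eU h 0 he; rewrite scaler0 addr0 addrC; apply; by rewrite normr0 ltW.
have L : h^-1 *: ((G \o shift x) (h *: v) - G x) @[h --> (0 : R)^'] --> d.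
  apply: cvg_trans; first exact: near_eq_cvg E.
  by rewrite -vF; exact: dF.
by split; [exact: cvgP L | rewrite /derive; exact: cvg_lim].
Qed.

Lemma Ck_on_continuous k F : Ck_on W k U F -> {within U, continuous F}.
Proof. by case: k => [|k] []. Qed.

Lemma Ck_on_derivable k F x v : Ck_on W k.+1 U F -> W v -> U x -> derivable F x v.
Proof. by move=> [_ +] Wv => /(_ v Wv) [+ _]; exact. Qed.

Lemma Ck_on_derive k F v : Ck_on W k.+1 U F -> W v -> Ck_on W k U ('D_v F).
Proof. by move=> [_ +] Wv => /(_ v Wv) []. Qed.

(** Directional derivatives alone need not be additive in the direction. The increment along [v + w]
    is split at [x + h *: v]; the second piece is [h] times ['D_w F] at a nearby point, and
    continuity of ['D_w F] carries it back to [x]. *)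
Lemma derive_dirD k F x v w : Ck_on W k.+1 U F -> U x -> W v -> W w ->
  'D_(v + w) F x = 'D_v F x + 'D_w F x.
Proof.
move=> CF Ux Wv Ww.
have L u : W u -> h^-1 *: ((F \o shift x) (h *: u) - F x) @[h --> (0 : R)^'+] --> 'D_u F x.
  move=> Wu; have := Ck_on_derivable CF Wu Ux; rewrite /derivable => dF.
  exact: cvg_dnbhs_at_right.
(* The derivative along [v + w] is already known to exist, so its one-sided limit identifies it;
   with [h] positive [MVT_line] applies. *)
suff H : h^-1 *: ((F \o shift x) (h *: (v + w)) - F x) @[h --> (0 : R)^'+] --> 'D_v F x + 'D_w F x.
  exact: (cvg_unique _ (L _ (WD Wv Ww)) H).
have [e e0 eU] := relopen_plane Ux Wv Ww.
have cw := Ck_on_continuous (Ck_on_derive CF Ww).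
apply/cvgrPdist_le => eps eps0.
have eps20 : 0 < eps / 2 by rewrite divr_gt0.
have [A [nA AU]] : exists A, nbhs x A /\ forall y, A y -> U y ->
    `|'D_w F x - 'D_w F y| <= eps / 2.
  move/subspace_continuousP : cw => /(_ x Ux) /cvgrPdist_le /(_ _ eps20).
  by rewrite near_withinE => nA; eexists; split; [exact: nA|].
have [r r0 rA] := nbhs_norm_le nA.
have D0 : 0 < 1 + `|v| + `|w| by rewrite -addrA ltr_pwDl// addr_ge0.
have Lv := L v Wv; move/cvgrPdist_le : Lv => /(_ _ eps20) Lv.
near=> h.
have h0 : 0 < h by near: h; exact: nbhs_right_gt.
have he : h <= e by near: h; exact: nbhs_right_le.
have hr : h * (1 + `|v| + `|w|) <= r.
  rewrite -ler_pdivlMr//; near: h; apply: nbhs_right_le; exact: divr_gt0.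
have hv : `|'D_v F x - h^-1 *: ((F \o shift x) (h *: v) - F x)| <= eps / 2.
  by near: h; exact: Lv.
have he' : `|h| <= e by rewrite gtr0_norm.
have [s /andP[s0 sh] E] : exists2 s, 0 <= s <= h &
    F (x + h *: v + h *: w) - F (x + h *: v) = h * 'D_w F (x + h *: v + s *: w).
  apply: (MVT_line (G := 'D_w F)) => // s /andP[s0 sh]; apply/derivableP.
  apply: (Ck_on_derivable CF Ww); apply: eU => //.
  by rewrite ger0_norm// (le_trans sh).
have Us : U (x + h *: v + s *: w) by apply: eU => //; rewrite ger0_norm// (le_trans sh).
have Aw : `|'D_w F x - 'D_w F (x + h *: v + s *: w)| <= eps / 2.
  apply: AU => //; rewrite -addrA; apply: rA.
  rewrite (le_trans (ler_normD _ _))// !normrZ !ger0_norm// ?(ltW h0)//.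
  rewrite (le_trans _ hr)// !mulrDr -addrA ler_wpDl ?mulr1 ?(ltW h0)// lerD2l.
  exact: ler_wpM2r.
rewrite (_ : _ - _ = ('D_v F x - h^-1 *: ((F \o shift x) (h *: v) - F x)) +
   ('D_w F x - 'D_w F (x + h *: v + s *: w))).
  by rewrite (le_trans (ler_normD _ _))// [leRHS](splitr eps) lerD.
have q (u : R) : h^-1 *: u = h^-1 * u by [].
rewrite /= !q scalerDr (addrC (_ + _) x) addrA (addrC (h *: v) x).
have -> : 'D_w F (x + h *: v + s *: w) = h^-1 * (F (x + h *: v + h *: w) - F (x + h *: v)).
  by rewrite E mulKf// gt_eqF.
ring.
Unshelve. all: by end_near. Qed.

Lemma derive_dirZ k F x v a : Ck_on W k.+1 U F -> U x -> W v ->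
  'D_(a *: v) F x = a * 'D_v F x.
Proof.
move=> CF Ux Wv; apply: (@derive_val _ _ _ _ _ _ _ (is_deriveZdir _ _)).
exact: derivableP (Ck_on_derivable CF Wv Ux).
Qed.

Lemma W_sum n (c : 'I_n -> R) (B : 'I_n -> V) (P : pred 'I_n) : (forall i, W (B i)) ->
  W (\sum_(i | P i) c i *: B i).
Proof. by move=> WB; apply: big_ind => //= i _; exact: WZ. Qed.

Lemma derive_dir_sum k F x n (c : 'I_n -> R) (B : 'I_n -> V) :
  Ck_on W k.+1 U F -> U x -> (forall i, W (B i)) ->
  'D_(\sum_i c i *: B i) F x = \sum_i c i * 'D_(B i) F x.
Proof.
move=> CF Ux WB.
pose K u r := W u /\ 'D_u F x = r.
suff [] : K (\sum_i c i *: B i) (\sum_i c i * 'D_(B i) F x) by [].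
apply: (big_ind2 K) => [|u r v s [Wu <-] [Wv <-]|i _].
- by split=> //; exact: derive0.
- by split; [exact: WD | exact: derive_dirD CF _ _ _].
- by split; [exact: WZ | exact: derive_dirZ CF _ _].
Qed.

(* Makes the third derivative jointly continuous in the point and the direction. *)
Lemma derive3_expand F x w n (c : 'I_n -> R) (B : 'I_n -> V) :
  Ck_on W 3 U F -> U x -> W w -> (forall i, W (B i)) ->
  let Z := \sum_i c i *: B i in
  'D_w ('D_Z ('D_Z F)) x =
  \sum_i \sum_j c i * c j * 'D_w ('D_(B i) ('D_(B j) F)) x.
Proof.
move=> CF Ux Ww WB Z.
have WZ' : W Z by exact: W_sum.
have E1 y : U y -> 'D_Z F y = (\sum_j c j \*: 'D_(B j) F) y.
  by move=> Uy; rewrite fct_sumE (derive_dir_sum _ CF).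
have E2 y : U y -> 'D_Z ('D_Z F) y = (\sum_i \sum_j (c i * c j) \*: 'D_(B i) ('D_(B j) F)) y.
  move=> Uy; rewrite (derive_dir_sum _ (Ck_on_derive CF WZ'))// fct_sumE.
  apply: eq_bigr => i _.
  have dS : is_derive y (B i) (\sum_j c j \*: 'D_(B j) F) (\sum_j c j *: 'D_(B i) ('D_(B j) F) y).
    apply: is_derive_sum => j; apply: is_deriveZ; apply: derivableP.
    exact: Ck_on_derivable (Ck_on_derive CF (WB j)) (WB i) Uy.
  have -> := @derive_val _ _ _ _ _ _ _ (is_derive_eq_on Uy (WB i) _ dS); last first.
    by move=> u; rewrite inE => Uu; rewrite E1.
  by rewrite fct_sumE mulr_sumr; apply: eq_bigr => j _; rewrite mulrA.
have dS : is_derive x w (\sum_i \sum_j (c i * c j) \*: 'D_(B i) ('D_(B j) F))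
   (\sum_i \sum_j (c i * c j) *: 'D_w ('D_(B i) ('D_(B j) F)) x).
  apply: is_derive_sum => i; apply: is_derive_sum => j; apply: is_deriveZ; apply: derivableP.
  exact: Ck_on_derivable (Ck_on_derive (Ck_on_derive CF (WB j)) (WB i)) Ww Ux.
apply: (@derive_val _ _ _ _ _ _ _ (is_derive_eq_on Ux Ww _ dS)).
by move=> u; rewrite inE => Uu; rewrite E2.
Qed.

End RelativelyOpen.

(** * Sign and monotonicity of a profile with positive third derivative *)

Section Monotonicity.
Variable R : realType.
Implicit Types g dg f : R -> R.

(** Its negation is a weak form of decay at minus infinity which, unlike a limit equal to 0, passes
    from a function to its derivative without further work. *)
Definition bounded_away_at_ninfty g : Prop :=
  exists c s0 : R, [/\ 0 < c, s0 < 0 & forall s, s <= s0 -> c <= `|g s|].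

Lemma MVT_neg g dg (a b : R) : (forall s : R, s < 0 -> is_derive s 1 g (dg s)) ->
  a < b -> b < 0 -> exists2 s, a <= s <= b & g b - g a = dg s * (b - a).
Proof.
move=> dF ab b0.
have ba : 0 < b - a by rewrite subr_gt0.
have [|s /andP[s0 sh]] := @MVT_line _ R^o g dg a 1 (b - a) ba.
  move=> s /andP[s0 sh]; rewrite /GRing.scale /= mulr1; apply: dF; lra.
rewrite /GRing.scale /= !mulr1 (addrC a (b - a)) subrK mulrC => E.
by exists (a + s) => //; lra.
Qed.

(** A derivative of absolute value at least [c] makes the function grow at least linearly, by the
    mean value theorem. The contrapositive hands the failure of the property down from f to f' and
    f''. *)
Lemma bounded_away_antiderivative g dg :
  (forall s : R, s < 0 -> is_derive s 1 g (dg s)) ->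
  bounded_away_at_ninfty dg -> bounded_away_at_ninfty g.
Proof.
move=> dF [c [s0 [c0 s00 cb]]].
(* Below this threshold [c * (s0 - s)] exceeds [1 + |g s0|], which forces [|g s|] to be at least 1;
   the final [- 1] keeps [s] strictly below [s0]. *)
exists 1, (s0 - (1 + `|g s0|) / c - 1); split => //.
  have : 0 <= (1 + `|g s0|) / c by rewrite divr_ge0 ?addr_ge0// ltW.
  lra.
move=> s ss.
have k0 : 0 <= (1 + `|g s0|) / c by rewrite divr_ge0 ?addr_ge0// ltW.
have ss0 : s < s0 by lra.
have [t /andP[st ts0] E] := MVT_neg dF ss0 s00.
have : c * (s0 - s) <= `|g s0 - g s|.
  rewrite E normrM (gtr0_norm (_ : 0 < s0 - s)) ?subr_gt0//.
  by rewrite ler_wpM2r ?cb// subr_ge0 ltW.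
have : 1 + `|g s0| <= c * (s0 - s).
  by rewrite mulrC -ler_pdivrMr//; lra.
have := ler_normB (g s0) (g s); lra.
Qed.

(** An increasing function that is nonpositive somewhere is negative further left, and stays below a
    negative constant from there on. *)
Lemma pos_derivative_pos g dg :
  (forall s : R, s < 0 -> is_derive s 1 g (dg s)) ->
  ~ bounded_away_at_ninfty g -> (forall s, s < 0 -> 0 < dg s) ->
  forall s, s < 0 -> 0 < g s.
Proof.
move=> dF nb dpos s s0; rewrite ltNge; apply/negP => gs; apply: nb.
have mono a b : a < b -> b < 0 -> g a < g b.
  move=> ab b0; have [t /andP[_ tb] E] := MVT_neg dF ab b0.
  rewrite -subr_gt0 E mulr_gt0 ?subr_gt0//; apply: dpos; lra.
(* One unit to the left of [s] the value is strictly negative even if [g s = 0]. *)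
exists (- g (s - 1)), (s - 1).
have g1 : g (s - 1) < 0 by rewrite (lt_le_trans (mono _ s _ _))//; lra.
split; [by rewrite oppr_gt0 | lra |].
move=> t; rewrite le_eqVlt => /predU1P[->|ts]; first by rewrite ltr0_norm.
have gt : g t < g (s - 1) by apply: mono => //; lra.
by rewrite ltr0_norm ?(lt_trans gt)// lerN2 ltW.
Qed.

Lemma pos_third_derivative (f f1 f2 f3 : R -> R) :
  (forall s : R, s < 0 -> is_derive s 1 f (f1 s)) ->
  (forall s : R, s < 0 -> is_derive s 1 f1 (f2 s)) ->
  (forall s : R, s < 0 -> is_derive s 1 f2 (f3 s)) ->
  (forall s, s < 0 -> 0 < f3 s) -> ~ bounded_away_at_ninfty f ->
  (forall s, s < 0 -> 0 < f s) /\ (forall s t, s <= t -> t < 0 -> f s <= f t).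
Proof.
move=> d1 d2 d3 f3p nb.
have nb1 : ~ bounded_away_at_ninfty f1 by move=> /(bounded_away_antiderivative d1).
have nb2 : ~ bounded_away_at_ninfty f2 by move=> /(bounded_away_antiderivative d2).
have f1p := pos_derivative_pos d2 nb1 (pos_derivative_pos d3 nb2 f3p).
split; first exact: pos_derivative_pos d1 nb f1p.
move=> s t; rewrite le_eqVlt => /predU1P[->//|st t0].
have [u /andP[_ ut] E] := MVT_neg d1 st t0.
rewrite -subr_ge0 E mulr_ge0 ?subr_ge0// ltW//; apply: f1p; lra.
Qed.

End Monotonicity.

(** * Minkowski algebra and the cone *)

Section MinkowskiAlgebra.
Variable R : realType.
Implicit Types (u v p l t : 'rV[R]_4) (S : 'M[R]_4) (k : R * R * R).

Lemma sum4 (F : 'I_4 -> R) : \sum_a F a = F 0 + F 1 + F 2%:R + F 3%:R.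
Proof.
rewrite !big_ord_recl big_ord0 addr0 !addrA.
by congr (F _ + F _ + F _ + F _); apply/val_inj.
Qed.

Lemma ord4_cases (P : 'I_4 -> Prop) : P 0 -> P 1 -> P 2%:R -> P 3%:R -> forall a, P a.
Proof.
move=> P0 P1 P2 P3 [[|[|[|[|//]]]] i].
- by rewrite (_ : Ordinal i = 0); [|exact/val_inj].
- by rewrite (_ : Ordinal i = 1); [|exact/val_inj].
- by rewrite (_ : Ordinal i = 2%:R); [|exact/val_inj].
- by rewrite (_ : Ordinal i = 3%:R); [|exact/val_inj].
Qed.

Lemma lowerE v a : lower v 0 a = if a == 0 then - v 0 0 else v 0 a.
Proof.
rewrite /lower mxE (bigD1 a)//= big1 ?addr0 => [|b ba]; rewrite mxE ?eqxx.
  by case: eqP => [->|_]; rewrite ?mulrN1 ?mulr1.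
by rewrite (negbTE ba) mulr0.
Qed.

Lemma dotE u v :
  dot u v = - (u 0 0 * v 0 0) + u 0 1 * v 0 1 + u 0 2%:R * v 0 2%:R + u 0 3%:R * v 0 3%:R.
Proof. by rewrite /dot sum4 !lowerE /= mulNr. Qed.

Lemma dotDr u v w : dot u (v + w) = dot u v + dot u w.
Proof. by rewrite !dotE !mxE; ring. Qed.

Lemma dotZr a u v : dot u (a *: v) = a * dot u v.
Proof. by rewrite !dotE !mxE; ring. Qed.

Lemma dot2D p S S' : dot2 p (S + S') = dot2 p S + dot2 p S'.
Proof.
rewrite /dot2 -big_split /=; apply: eq_bigr => a _; rewrite -big_split.
by apply: eq_bigr => b _; rewrite /= -mulrDr; congr (_ * _); rewrite mxE.
Qed.

Lemma dot2Z c p S : dot2 p (c *: S) = c * dot2 p S.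
Proof.
rewrite /dot2 mulr_sumr; apply: eq_bigr => a _; rewrite mulr_sumr.
by apply: eq_bigr => b _; rewrite mulrCA; congr (_ * _); rewrite mxE.
Qed.

Lemma dot20 p : dot2 p 0 = 0.
Proof. by rewrite -(scale0r (0 : 'M[R]_4)) dot2Z mul0r. Qed.

Lemma tracefree_sym0 : tracefree_sym (0 : 'M[R]_4).
Proof.
split; first exact: trmx0.
by rewrite big1 // => a _; rewrite big1 // => b _; rewrite !mxE mulr0.
Qed.

Lemma tracefree_symD S S' : tracefree_sym S -> tracefree_sym S' -> tracefree_sym (S + S').
Proof.
move=> [sS tS] [sS' tS']; split; first by rewrite linearD /= sS sS'.
rewrite -[RHS]addr0 -[X in _ = X + _]tS -[X in _ = _ + X]tS' -big_split /=; apply: eq_bigr => a _.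
by rewrite -big_split /=; apply: eq_bigr => b _; rewrite -mulrDr; congr (_ * _); rewrite mxE.
Qed.

Lemma tracefree_symZ c S : tracefree_sym S -> tracefree_sym (c *: S).
Proof.
move=> [sS tS]; split; first by rewrite linearZ /= sS.
rewrite -[RHS](mulr0 c) -[X in _ = c * X]tS mulr_sumr; apply: eq_bigr => a _.
by rewrite mulr_sumr; apply: eq_bigr => b _; rewrite mulrCA; congr (_ * _); rewrite mxE.
Qed.

Definition future_causal t : Prop := dot t t <= 0 /\ 0 < t 0 0.

Lemma future_timelike_causal t : future_timelike t -> future_causal t.
Proof. by move=> [/ltW]. Qed.

Lemma lt_of_sqr (x y : R) : 0 < y -> x ^+ 2 < y ^+ 2 -> x < y.
Proof.
move=> y0 xy; rewrite ltNge; apply/negP => yx; move: xy.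
have x0 : 0 <= x := le_trans (ltW y0) yx.
by rewrite ltNge ler_sqr ?nnegrE ?(ltW y0)// yx.
Qed.

(** The reversed Cauchy-Schwarz inequality: the spatial product is compared with the product of the
    time components. Strictness comes from [p] being timelike together with a nonzero time component
    of [t]. *)
Lemma dot_timelike_causal p t : future_timelike p -> future_causal t -> dot p t < 0.
Proof.
move=> [+ p0] [+ t0]; rewrite !dotE => pp tt.
rewrite -addrA -addrA addrC subr_lt0; apply: lt_of_sqr; first exact: mulr_gt0.
move: (p 0 0) (p 0 1) (p 0 2%:R) (p 0 3%:R) (t 0 0) (t 0 1) (t 0 2%:R) (t 0 3%:R) p0 t0 pp tt.
move=> p0 p1 p2 p3 t0 t1 t2 t3 hp0 ht0 pp tt.
have pp' : p1 ^+ 2 + p2 ^+ 2 + p3 ^+ 2 < p0 ^+ 2 by lra.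
have tt' : t1 ^+ 2 + t2 ^+ 2 + t3 ^+ 2 <= t0 ^+ 2 by lra.
rewrite exprMn.
have t20 : 0 < t0 ^+ 2 by rewrite exprn_gt0.
apply: le_lt_trans (_ : (p1 ^+ 2 + p2 ^+ 2 + p3 ^+ 2) * t0 ^+ 2 < _); last by rewrite ltr_pM2r.
apply: le_trans (_ : (p1 ^+ 2 + p2 ^+ 2 + p3 ^+ 2) * (t1 ^+ 2 + t2 ^+ 2 + t3 ^+ 2) <= _); last first.
  by rewrite ler_wpM2l// !addr_ge0// sqr_ge0.
(* Lagrange's identity: these three squares sum to the defect in the spatial Cauchy-Schwarz
   inequality. *)
have s1 := sqr_ge0 (p1 * t2 - p2 * t1); have s2 := sqr_ge0 (p1 * t3 - p3 * t1).
have s3 := sqr_ge0 (p2 * t3 - p3 * t2).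
rewrite -subr_ge0; apply: le_trans (addr_ge0 (addr_ge0 s1 s2) s3) _.
by rewrite le_eqVlt; apply/orP; left; apply/eqP; ring.
Qed.

(* Testing against causal rather than timelike [t] makes the conclusion strict. *)
Lemma future_timelike_dual p :
  (forall t, future_causal t -> dot t p < 0) -> future_timelike p.
Proof.
move=> H.
(* With [s] equal to the spatial length r of [p], [tv s] is the null vector sharing the spatial part
   of [p], and testing against it reads r^2 < r p^0. For r = 0 it is not future-directed, hence the
   separate case. *)
pose tv (s : R) := \row_a (if a == 0 :> 'I_4 then s else p 0 a).
have [p0 [r0 rE]] : 0 < p 0 0 /\ exists2 r, 0 <= r & r ^+ 2 = p 0 1 ^+ 2 + p 0 2%:R ^+ 2 + p 0 3%:R ^+ 2.
  split.
    have : future_causal (delta_mx 0 0 : 'rV[R]_4).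
      by rewrite /future_causal dotE !mxE /= !mulr0 !addr0 mulr1 oppr_le0 ler01 ltr01.
    by move=> /H; rewrite dotE !mxE /= !mul0r !addr0 mul1r oppr_lt0.
  exists (Num.sqrt (p 0 1 ^+ 2 + p 0 2%:R ^+ 2 + p 0 3%:R ^+ 2)); first exact: sqrtr_ge0.
  by rewrite sqr_sqrtr// !addr_ge0// sqr_ge0.
move=> rsq; split=> //; rewrite dotE.
have [rz|rnz] := eqVneq r0 0.
  have : 0 < p 0 0 ^+ 2 by rewrite exprn_gt0.
  by move: rsq; rewrite rz expr0n /=; lra.
have rp : 0 < r0 by rewrite lt_def rnz.
have /H : future_causal (tv r0) by rewrite /future_causal dotE !mxE /=; split=> //; lra.
rewrite dotE !mxE /= => E.
have : r0 < p 0 0.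
  by rewrite -(ltr_pM2l rp); lra.
move=> lt; have : r0 * r0 < p 0 0 * p 0 0 by rewrite ltr_pM// ltW.
lra.
Qed.

(** The rotation-invariant trace-free tensor of the frame: the entry -3 is forced by the trace
    condition once the spatial entries are -1. Its pairing with a causal vector is at most -3
    (p^0)^2, so it lies in the interior of the cone. *)
Definition cone_axis : 'M[R]_4 :=
  \matrix_(a, b) (if a == b then (if a == 0 then -3 else -1) else 0).

Lemma dot2_cone_axis p :
  dot2 p cone_axis = - (3 * p 0 0 ^+ 2 + p 0 1 ^+ 2 + p 0 2%:R ^+ 2 + p 0 3%:R ^+ 2).
Proof. by rewrite /dot2 !sum4 !lowerE !mxE /=; ring. Qed.

Lemma tracefree_sym_cone_axis : tracefree_sym cone_axis.
Proof.
split; first by apply/matrixP => a b; rewrite !mxE eq_sym; case: eqP => [->|].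
by rewrite !sum4 !mxE /=; ring.
Qed.

Definition mx_sum_norm S : R := \sum_a \sum_b `|S a b|.

Lemma norm_dot2_le p S : dot p p <= 0 -> `|dot2 p S| <= p 0 0 ^+ 2 * mx_sum_norm S.
Proof.
rewrite dotE => pp.
have pa a : `|lower p 0 a| <= `|p 0 0|.
  rewrite lowerE; case: eqP => [_|a0]; first by rewrite normrN.
  rewrite -ler_sqr ?nnegrE// !real_normK ?num_real//.
  have := sqr_ge0 (p 0 1); have := sqr_ge0 (p 0 2%:R); have := sqr_ge0 (p 0 3%:R).
  by move: a a0; apply: ord4_cases => // _; lra.
rewrite /dot2 /mx_sum_norm mulr_sumr; apply: le_trans (ler_norm_sum _ _ _) _.
apply: ler_sum => a _; rewrite mulr_sumr; apply: le_trans (ler_norm_sum _ _ _) _.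
apply: ler_sum => b _; rewrite !normrM ler_wpM2r//.
by rewrite -[leRHS]real_normK ?num_real// expr2 ler_pM.
Qed.

(* Every direction can be followed inside the cone after moving along its axis. *)
Lemma dot2_shifted_le0 p S (h s : R) : dot p p <= 0 -> 0 <= s <= 2 * h ->
  dot2 p ((h * mx_sum_norm S) *: cone_axis + s *: S) <= 0.
Proof.
move=> pp /andP[s0 s2h]; rewrite dot2D !dot2Z dot2_cone_axis.
have h0 : 0 <= h by lra.
have M0 : 0 <= mx_sum_norm S.
  by rewrite /mx_sum_norm sumr_ge0// => a _; rewrite sumr_ge0.
have := norm_dot2_le S pp; have := ler_norm (dot2 p S).
set d := dot2 p S; set M := mx_sum_norm S in M0 *; move=> d1 d2.
(* The direction contributes at most 2 h M (p^0)^2, against at most -3 h M (p^0)^2 from the axis: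
   steps of total length [2 * h] still fit. *)
have sd : s * d <= 2 * h * (p 0 0 ^+ 2 * M).
  apply: le_trans (_ : s * (p 0 0 ^+ 2 * M) <= _).
    by rewrite ler_wpM2l// (le_trans d1).
  by rewrite ler_wpM2r// mulr_ge0// sqr_ge0.
have hM : 0 <= h * M by rewrite mulr_ge0.
have := mulr_ge0 hM (sqr_ge0 (p 0 0)); have := mulr_ge0 hM (sqr_ge0 (p 0 1)).
have := mulr_ge0 hM (sqr_ge0 (p 0 2%:R)); have := mulr_ge0 hM (sqr_ge0 (p 0 3%:R)).
lra.
Qed.

Lemma Cminus_shifted S (h s : R) : tracefree_sym S -> 0 <= s <= 2 * h ->
  Cminus ((h * mx_sum_norm S) *: cone_axis + s *: S).
Proof.
move=> tS sh; split.
  by apply: tracefree_symD; apply: tracefree_symZ => //; exact: tracefree_sym_cone_axis.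
by move=> l l0; apply: dot2_shifted_le0 => //; rewrite l0.
Qed.

End MinkowskiAlgebra.

(** * The pairing of dynamical variables with momenta on the shell *)

Section ShellPairing.
Variables (R : realType) (m : R).
Hypothesis m0 : 0 < m.
Implicit Types (k : R * R * R) (p : 'rV[R]_4) (y Z : dynvar R).

(** The argument of f in the generating function. Being linear in [y], it serves both for states and
    for perturbations, where it is the factor produced by each derivative. *)
Definition pairing p y : R := y.1.1 + dot p y.1.2 + dot2 p y.2.

Lemma pairingD p y Z : pairing p (y + Z) = pairing p y + pairing p Z.
Proof. by rewrite /pairing dotDr dot2D /=; ring. Qed.

Lemma pairingZ p a y : pairing p (a *: y) = a * pairing p y.
Proof. by rewrite /pairing dotZr dot2Z /= /GRing.scale /=; ring. Qed.

Lemma energy_gt0 k : 0 < energy m k.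
Proof.
by rewrite sqrtr_gt0 !ltr_wpDr ?sqr_ge0// exprn_gt0.
Qed.

Lemma energy_sqr k : energy m k ^+ 2 = m ^+ 2 + k.1.1 ^+ 2 + k.1.2 ^+ 2 + k.2 ^+ 2.
Proof. by rewrite sqr_sqrtr// !addr_ge0// sqr_ge0. Qed.

Lemma energy_eq k e : 0 <= e -> e ^+ 2 = m ^+ 2 + k.1.1 ^+ 2 + k.1.2 ^+ 2 + k.2 ^+ 2 ->
  energy m k = e.
Proof. by move=> e0 E; rewrite /energy -E sqrtr_sqr ger0_norm. Qed.

Lemma shellE k : [/\ shell m k 0 0 = energy m k, shell m k 0 1 = k.1.1,
  shell m k 0 2%:R = k.1.2 & shell m k 0 3%:R = k.2].
Proof. by rewrite !mxE. Qed.

Lemma shell_timelike k : future_timelike (shell m k).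
Proof.
rewrite /future_timelike dotE; have [-> -> -> ->] := shellE k.
split; last exact: energy_gt0.
have : 0 < m ^+ 2 by rewrite exprn_gt0.
by have := energy_sqr k; lra.
Qed.

Lemma pairing_shellE k Z : pairing (shell m k) Z =
  Z.1.1 - energy m k * Z.1.2 0 0 + k.1.1 * Z.1.2 0 1 + k.1.2 * Z.1.2 0 2%:R
    + k.2 * Z.1.2 0 3%:R + dot2 (shell m k) Z.2.
Proof.
by rewrite /pairing dotE; have [-> -> -> ->] := shellE k; ring.
Qed.

Lemma dot2_shellE k S : dot2 (shell m k) S =
  energy m k ^+ 2 * S 0 0 - energy m k * k.1.1 * (S 0 1 + S 1 0)
  - energy m k * k.1.2 * (S 0 2%:R + S 2%:R 0) - energy m k * k.2 * (S 0 3%:R + S 3%:R 0)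
  + k.1.1 ^+ 2 * S 1 1 + k.1.2 ^+ 2 * S 2%:R 2%:R + k.2 ^+ 2 * S 3%:R 3%:R
  + k.1.1 * k.1.2 * (S 1 2%:R + S 2%:R 1) + k.1.1 * k.2 * (S 1 3%:R + S 3%:R 1)
  + k.1.2 * k.2 * (S 2%:R 3%:R + S 3%:R 2%:R).
Proof.
by rewrite /dot2 !sum4 !lowerE /=; have [-> -> -> ->] := shellE k; ring.
Qed.

(* Restriction of the pairing to one spatial axis of the shell, sampled at the
   energies [2 m] and [3 m]; [q] and [Q] are the time-time and time-axis entries. *)
Let axis_system (z v0 v1 q Q S a b : R) :
  0 < a -> 0 < b -> a ^+ 2 = 3 * m ^+ 2 -> b ^+ 2 = 8 * m ^+ 2 ->
  z - m * v0 + m ^+ 2 * q = 0 ->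
  (forall e s, (e, s) \in [:: (2 * m, a); (2 * m, - a); (3 * m, b); (3 * m, - b)] ->
     z - e * v0 + s * v1 + e ^+ 2 * q - e * s * (Q + Q) + s ^+ 2 * S = 0) ->
  [/\ v0 = 0, v1 = 0, Q = 0 & S = - q].
Proof.
move=> a0 b0 aE bE E0 H.
have /= A1 := H _ _ (mem_head _ _).
have A2 : z - (2 * m) * v0 + (- a) * v1 + (2 * m) ^+ 2 * q - (2 * m) * (- a) * (Q + Q) + (- a) ^+ 2 * S = 0.
  by apply: H; rewrite !inE eqxx orbT.
have A3 : z - (3 * m) * v0 + b * v1 + (3 * m) ^+ 2 * q - (3 * m) * b * (Q + Q) + b ^+ 2 * S = 0.
  by apply: H; rewrite !inE eqxx !orbT.
have A4 : z - (3 * m) * v0 + (- b) * v1 + (3 * m) ^+ 2 * q - (3 * m) * (- b) * (Q + Q) + (- b) ^+ 2 * S = 0.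
  by apply: H; rewrite !inE eqxx !orbT.
(* Opposite momenta isolate the odd terms; the two energies then separate [v1] from [Q]. *)
have B1 : a * (v1 - 4 * (m * Q)) = 0 by lra.
have B2 : b * (v1 - 6 * (m * Q)) = 0 by lra.
move/eqP: B1; rewrite mulf_eq0 gt_eqF//= => /eqP B1.
move/eqP: B2; rewrite mulf_eq0 gt_eqF//= => /eqP B2.
have C1 : m * Q = 0 by lra.
have aS : a ^+ 2 * S = 3 * (m ^+ 2 * S) by rewrite aE; ring.
have bS : b ^+ 2 * S = 8 * (m ^+ 2 * S) by rewrite bE; ring.
(* The even parts are taken at energies [m], [2 * m], [3 * m], in arithmetic progression: their
   second difference eliminates [z] and [v0], after which a first difference gives [v0]. *)
have D1 : m ^+ 2 * (S + q) = 0 by lra.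
have D2 : m * v0 = 0 by lra.
move/eqP: C1; rewrite mulf_eq0 gt_eqF//= => /eqP Q0.
move/eqP: D2; rewrite mulf_eq0 gt_eqF//= => /eqP v00.
move/eqP: D1; rewrite mulf_eq0 expf_eq0 /= gt_eqF//= => /eqP Sq.
by split=> //; [move: B1; rewrite Q0; lra | lra].
Qed.

(* The trace condition is essential: on the shell the metric pairs to the
   constant [- m^2], which could cancel against the scalar component. *)
Lemma pairing_shell_eq0 Z : perturbation Z ->
  (forall k, pairing (shell m k) Z = 0) -> Z = 0.
Proof.
case: Z => [[z v] S] [/= sS tS] H.
have sym a b : S a b = S b a by rewrite -{1}sS mxE.
have H' k (e : R) : 0 <= e -> e ^+ 2 = m ^+ 2 + k.1.1 ^+ 2 + k.1.2 ^+ 2 + k.2 ^+ 2 ->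
  z - e * v 0 0 + k.1.1 * v 0 1 + k.1.2 * v 0 2%:R + k.2 * v 0 3%:R +
  (e ^+ 2 * S 0 0 - e * k.1.1 * (S 0 1 + S 0 1)
  - e * k.1.2 * (S 0 2%:R + S 0 2%:R) - e * k.2 * (S 0 3%:R + S 0 3%:R)
  + k.1.1 ^+ 2 * S 1 1 + k.1.2 ^+ 2 * S 2%:R 2%:R + k.2 ^+ 2 * S 3%:R 3%:R
  + k.1.1 * k.1.2 * (S 1 2%:R + S 1 2%:R) + k.1.1 * k.2 * (S 1 3%:R + S 1 3%:R)
  + k.1.2 * k.2 * (S 2%:R 3%:R + S 2%:R 3%:R)) = 0.
  move=> e0 eE; rewrite -(H k) pairing_shellE dot2_shellE /= (energy_eq e0 eE).
  by rewrite (sym 1 0) (sym 2%:R 0) (sym 3%:R 0) (sym 2%:R 1) (sym 3%:R 1) (sym 3%:R 2%:R).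
have mm0 : 0 < m ^+ 2 by rewrite exprn_gt0.
have [a [a0 aE]] : exists a : R, 0 < a /\ a ^+ 2 = 3 * m ^+ 2.
  exists (Num.sqrt (3 * m ^+ 2)); rewrite sqrtr_gt0 sqr_sqrtr ?mulr_ge0 ?ltW//.
  by rewrite mulr_gt0.
have [b [b0 bE]] : exists b : R, 0 < b /\ b ^+ 2 = 8 * m ^+ 2.
  exists (Num.sqrt (8 * m ^+ 2)); rewrite sqrtr_gt0 sqr_sqrtr ?mulr_ge0 ?ltW//.
  by rewrite mulr_gt0.
have E0 : z - m * v 0 0 + m ^+ 2 * S 0 0 = 0.
  have := H' (0, 0, 0) m; rewrite /= => <-; [ring | exact: ltW | ring].
have sq (e s : R) : (e, s) \in [:: (2 * m, a); (2 * m, - a); (3 * m, b); (3 * m, - b)] ->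
    0 <= e /\ e ^+ 2 = m ^+ 2 + s ^+ 2.
  by rewrite !inE => /or4P[] /eqP[-> ->]; rewrite ?sqrrN ?aE ?bE; split; have := m0; lra.
have X1 := axis_system a0 b0 aE bE E0 (v1 := v 0 1) (Q := S 0 1) (S := S 1 1).
case: X1 => [e s es|v00 v1 Q1 S11].
  have [e0 eE] := sq _ _ es.
  by have := H' (s, 0, 0) e; rewrite /= => <- //; [ring | rewrite eE; ring].
have X2 := axis_system a0 b0 aE bE E0 (v1 := v 0 2%:R) (Q := S 0 2%:R) (S := S 2%:R 2%:R).
case: X2 => [e s es|_ v2 Q2 S22].
  have [e0 eE] := sq _ _ es.
  by have := H' (0, s, 0) e; rewrite /= => <- //; [ring | rewrite eE; ring].
have X3 := axis_system a0 b0 aE bE E0 (v1 := v 0 3%:R) (Q := S 0 3%:R) (S := S 3%:R 3%:R).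
case: X3 => [e s es|_ v3 Q3 S33].
  have [e0 eE] := sq _ _ es.
  by have := H' (0, 0, s) e; rewrite /= => <- //; [ring | rewrite eE; ring].
(* Each spatial diagonal entry is the opposite of [S 0 0], so the trace equals -4 times [S 0 0]. *)
move: tS; rewrite !sum4 !mxE /= => tS.
have S00 : S 0 0 = 0 by lra.
have z0 : z = 0 by move: E0; rewrite v00 S00; lra.
(* Momenta with two components equal to [m] reach the mixed spatial entries; all three have this
   same energy. *)
have e0 : 0 <= Num.sqrt (m ^+ 2 + m ^+ 2 + m ^+ 2) by exact: sqrtr_ge0.
have eE : Num.sqrt (m ^+ 2 + m ^+ 2 + m ^+ 2) ^+ 2 = m ^+ 2 + m ^+ 2 + m ^+ 2.
  by rewrite sqr_sqrtr// !addr_ge0 // ltW.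
have mS s : m ^+ 2 * s = 0 -> s = 0.
  by move/eqP; rewrite mulf_eq0 gt_eqF//= => /eqP.
have S12 : S 1 2%:R = 0.
  have := H' (m, m, 0) _ e0; rewrite /= eE z0 v00 v1 v2 v3 Q1 Q2 Q3 S11 S22 S33 S00.
  by move=> E; apply: mS; have := E ltac:(ring); lra.
have S13 : S 1 3%:R = 0.
  have := H' (m, 0, m) _ e0; rewrite /= eE z0 v00 v1 v2 v3 Q1 Q2 Q3 S11 S22 S33 S00.
  by move=> E; apply: mS; have := E ltac:(ring); lra.
have S23 : S 2%:R 3%:R = 0.
  have := H' (0, m, m) _ e0; rewrite /= eE z0 v00 v1 v2 v3 Q1 Q2 Q3 S11 S22 S33 S00.
  by move=> E; apply: mS; have := E ltac:(ring); lra.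
congr (_, _, _) => //.
  by apply/rowP; apply: ord4_cases; rewrite mxE.
by apply/matrixP; apply: ord4_cases; apply: ord4_cases; rewrite mxE ?S11 ?S22 ?S33 ?S00 ?oppr0 // sym.
Qed.

Lemma pairing_lt0 k y : eq_state y.1 -> dot2 (shell m k) y.2 <= 0 ->
  pairing (shell m k) y < 0.
Proof.
move=> [y0 y1] y2; rewrite /pairing.
have := dot_timelike_causal (shell_timelike k) (future_timelike_causal y1); lra.
Qed.

End ShellPairing.

(** * Integrals over the mass shell *)

Lemma cvg_finite_sum (R : realType) (T : Type) (F : set_system T) (I : finType)
    (g : I -> T -> R) (l : I -> R) : Filter F ->
  (forall i, g i u @[u --> F] --> l i) -> \sum_i g i u @[u --> F] --> \sum_i l i.
Proof.
move=> FF gl; rewrite -fct_sumE.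
apply: (big_ind2 (fun (h : T -> R) (v : R) => h u @[u --> F] --> v)) => [|h1 v1 h2 v2 c1 c2|i _].
- exact: cvg_cst.
- exact: cvgD c1 c2.
- exact: gl.
Qed.

Lemma continuous_for_sum (R : realType) (T : topologicalType) (I : finType)
    (g : I -> T -> R) x : (forall i, {for x, continuous (g i)}) ->
  {for x, continuous (fun u => \sum_i g i u)}.
Proof. exact: cvg_finite_sum. Qed.

(** A Chebyshev bound. It makes positivity of an integral quantitative, so that the bound survives
    division by [h ^+ 3] and passage to the limit. *)
Lemma Rintegral_ge_cst d (T : measurableType d) (R : realType) (mu : {measure set T -> \bar R})
    (K : set T) (g : T -> R) (c : R) :
  measurable K -> (mu K < +oo)%E -> mu.-integrable setT (EFin \o g) ->
  (forall x, 0 <= g x) -> (forall x, K x -> c <= g x) ->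
  c * fine (mu K) <= Rintegral mu setT g.
Proof.
move=> mK fK ig g0 cg.
rewrite -Rintegral_cst// Rintegral_mkcond; apply: le_Rintegral => //; last first.
  by move=> x _; rewrite /patch; case: ifPn => [|_//]; rewrite inE; exact: cg.
have := @integrable_restrict _ _ _ mu K mK setT measurableT (cst c%:E).
rewrite restrict_EFin => -[+ _]; apply.
rewrite setTI; apply/integrableP; split; first exact: measurable_cst.
under eq_integral do rewrite /= .
by rewrite integral_cst// lte_mul_pinfty.
Qed.

Section ShellMeasure.
Variables (R : realType) (m : R).
Hypothesis m0 : 0 < m.
Implicit Types (k : R * R * R) (y Z : dynvar R) (f : R -> R).

(** The closed ball of the product norm, whose volume is a product of interval lengths. *)
Definition cube k (r : R) : set (R * R * R) :=
  `[k.1.1 - r, k.1.1 + r] `*` `[k.1.2 - r, k.1.2 + r] `*` `[k.2 - r, k.2 + r].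

Lemma measurable_cube k r : measurable (cube k r).
Proof. by apply: measurableX; [apply: measurableX|]; exact: measurable_itv. Qed.

Lemma leb3_cube k r : 0 < r -> leb3 (cube k r) = ((2 * r) ^+ 3)%:E.
Proof.
move=> r0; have I (x : R) : lebesgue_measure (`[x - r, x + r]%classic : set R) = (2 * r)%:E.
  rewrite lebesgue_measure_itv /= lte_fin ltrD2l gtrN// -EFinD.
  by congr (_%:E); ring.
transitivity ((2 * r)%:E * (2 * r)%:E * (2 * r)%:E)%E; last first.
  by rewrite -!EFinM; congr (_%:E); ring.
rewrite /leb3 /cube product_measure1E//; last exact: measurableX.
congr (_ * _)%E; last exact: I.
pose A (x : R) : set R := `[x - r, x + r]%classic.
transitivity (lebesgue_measure (A k.1.1) * lebesgue_measure (A k.1.2))%E; last by rewrite !I.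
exact: product_measure1E.
Qed.

Lemma continuous_energy : continuous (energy m : R * R * R -> R).
Proof.
move=> k; apply: (@continuous_comp _ _ _ (fun k : R * R * R =>
  m ^+ 2 + k.1.1 ^+ 2 + k.1.2 ^+ 2 + k.2 ^+ 2) (@Num.sqrt R)); last exact: sqrt_continuous.
have c2 : {for k, continuous (fun k : R * R * R => k.2)} by exact: cvg_snd.
have c1 : {for k, continuous (fun k : R * R * R => k.1)} by exact: cvg_fst.
have c11 : {for k, continuous (fun k : R * R * R => k.1.1)}.
  by exact: (continuous_comp c1 cvg_fst).
have c12 : {for k, continuous (fun k : R * R * R => k.1.2)}.
  by exact: (continuous_comp c1 cvg_snd).
have X (g : R * R * R -> R) : {for k, continuous g} -> {for k, continuous (fun k => g k ^+ 2)}.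
  by move=> gk; exact: (continuous_comp gk (@exprn_continuous R 2 (g k))).
have D (g h : R * R * R -> R) : {for k, continuous g} -> {for k, continuous h} ->
  {for k, continuous (fun k => g k + h k)} by exact: cvgD.
by do 3![apply: (D); last exact: (X)]; exact: cvg_cst.
Qed.

Lemma lower_shellE k a : lower (shell m k) 0 a = nth 0 [:: - energy m k; k.1.1; k.1.2; k.2] a.
Proof.
rewrite lowerE; move: a; have [e0 e1 e2 e3] := shellE m k.
by apply: ord4_cases => /=; rewrite ?e0 ?e1 ?e2 ?e3.
Qed.

Lemma continuous_pairing (q : (R * R * R) * dynvar R) :
  {for q, continuous (fun q : (R * R * R) * dynvar R => pairing (shell m q.1) q.2)}.
Proof.
pose C (g : (R * R * R) * dynvar R -> R) := {for q, continuous g}.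
have D g h : C g -> C h -> C (fun u => g u + h u) by exact: cvgD.
have M g h : C g -> C h -> C (fun u => g u * h u) by exact: cvgM.
have S (I : finType) g : (forall i, C (g i)) -> C (fun u => \sum_(i : I) g i u).
  exact: continuous_for_sum.
have c1 : {for q, continuous (fun q : (R * R * R) * dynvar R => q.1)} by exact: cvg_fst.
have c2 : {for q, continuous (fun q : (R * R * R) * dynvar R => q.2)} by exact: cvg_snd.
have c11 : {for q, continuous (fun q : (R * R * R) * dynvar R => q.1.1)} by exact: (continuous_comp c1 cvg_fst).
have c21 : {for q, continuous (fun q : (R * R * R) * dynvar R => q.2.1)} by exact: (continuous_comp c2 cvg_fst).
have c212 : {for q, continuous (fun q : (R * R * R) * dynvar R => q.2.1.2)} by exact: (continuous_comp c21 cvg_snd).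
have c22 : {for q, continuous (fun q : (R * R * R) * dynvar R => q.2.2)} by exact: (continuous_comp c2 cvg_snd).
have cL a : C (fun q => lower (shell m q.1) 0 a).
  rewrite (_ : (fun q => _) = fun q : (R * R * R) * dynvar R =>
    nth 0 [:: - energy m q.1; q.1.1.1; q.1.1.2; q.1.2] a); last first.
    by apply/funext => u; exact: lower_shellE.
  move: a; apply: ord4_cases => /=.
  - by apply: cvgN; exact: (continuous_comp c1 (@continuous_energy q.1)).
  - exact: (continuous_comp c11 cvg_fst).
  - exact: (continuous_comp c11 cvg_snd).
  - exact: (continuous_comp c1 cvg_snd).
apply: (D); first apply: (D).
- exact: (continuous_comp c21 cvg_fst).
- apply: (S) => a; apply: (M); first exact: cL.
  exact: (continuous_comp c212 (@coord_continuous R 1 4 0 a q.2.1.2)).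
- apply: (S) => a; apply: (S) => b; apply: (M); first by apply: (M); exact: cL.
  exact: (continuous_comp c22 (@coord_continuous R 4 4 a b q.2.2)).
Qed.

Lemma measurable_energy : measurable_fun setT (energy m : R * R * R -> R).
Proof.
have F1 : measurable_fun setT (fun k : R * R * R => k.1.1).
  by apply: measurableT_comp; exact: measurable_fst.
have F2 : measurable_fun setT (fun k : R * R * R => k.1.2).
  by apply: measurableT_comp; [exact: measurable_snd | exact: measurable_fst].
apply: (measurableT_comp (continuous_measurable_fun (@sqrt_continuous R))).
do 3![apply: measurable_funD; last by apply: measurable_funX].
exact: measurable_cst.
Qed.

Lemma measurable_pairing y : measurable_fun setT (fun k : R * R * R => pairing (shell m k) y).
Proof.
have F1 : measurable_fun setT (fun k : R * R * R => k.1.1).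
  by apply: measurableT_comp; exact: measurable_fst.
have F2 : measurable_fun setT (fun k : R * R * R => k.1.2).
  by apply: measurableT_comp; [exact: measurable_snd | exact: measurable_fst].
have mL a : measurable_fun setT (fun k => lower (shell m k) 0 a).
  under eq_fun do rewrite lower_shellE.
  move: a; apply: ord4_cases => /=; [|exact: F1|exact: F2|exact: measurable_snd].
  by apply: measurableT_comp => //; exact: measurable_energy.
rewrite /pairing /dot /dot2.
apply: measurable_funD; first apply: measurable_funD; first exact: measurable_cst.
  by apply: measurable_sum => a; apply: measurable_funM.
apply: measurable_sum => a; apply: measurable_sum => b.
by apply: measurable_funM => //; apply: measurable_funM.
Qed.

End ShellMeasure.

(** The three components lie in [L, 2L], so E^2 is between L^2 and m^2 + 12 L^2; the factor 6 is a
    generous choice that avoids a square root. *)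
Lemma energy_bounds (R : realType) (m L E a b c : R) : 0 < m -> 0 < L -> 0 < E ->
  3 * L / 2 - L / 2 <= a -> a <= 3 * L / 2 + L / 2 ->
  3 * L / 2 - L / 2 <= b -> b <= 3 * L / 2 + L / 2 ->
  3 * L / 2 - L / 2 <= c -> c <= 3 * L / 2 + L / 2 ->
  E ^+ 2 = m ^+ 2 + a ^+ 2 + b ^+ 2 + c ^+ 2 -> L <= E <= m + 6 * L.
Proof.
move=> m0 L0 E0.
have -> : 3 * L / 2 - L / 2 = L by field.
have -> : 3 * L / 2 + L / 2 = 2 * L by field.
have sq (u : R) : L <= u -> u <= 2 * L -> L ^+ 2 <= u ^+ 2 <= 4 * L ^+ 2.
  move=> uL Lu; have u0 : 0 <= u := le_trans (ltW L0) uL.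
  have L20 : 0 <= 2 * L := le_trans u0 Lu.
  rewrite (_ : 4 * L ^+ 2 = (2 * L) ^+ 2); last by ring.
  by rewrite !ler_sqr ?nnegrE ?(ltW L0)// uL.
move=> a1 a2 b1 b2 c1 c2 Esq.
have /andP[a3 a4] := sq _ a1 a2; have /andP[b3 b4] := sq _ b1 b2.
have /andP[c3 c4] := sq _ c1 c2.
have mL := mulr_gt0 m0 L0; have L2 := sqr_ge0 L; have m2 := sqr_ge0 m.
have mL0 : 0 <= m + 6 * L by rewrite addr_ge0 ?mulr_ge0 ?ltW.
clear sq a1 a2 b1 b2 c1 c2.
apply/andP; split; rewrite -ler_sqr ?nnegrE ?(ltW L0) ?(ltW E0)// Esq; clear Esq; first lra.
have -> : (m + 6 * L) ^+ 2 = m ^+ 2 + 12 * (m * L) + 36 * L ^+ 2 by ring.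
lra.
Qed.

(** * The profile function f on the mass shell *)

Section ProfileFunction.
Variables (R : realType) (m : R).
Hypothesis m0 : 0 < m.
Implicit Types (k : R * R * R) (y : dynvar R) (f : R -> R).

Lemma manifestly_causal_derivatives f : Ck_on setT 3 [set x : R | x < 0] f ->
  manifestly_causal f -> exists f1 f2 f3 : R -> R,
  [/\ forall s : R, s < 0 -> is_derive s 1 f (f1 s),
      forall s : R, s < 0 -> is_derive s 1 f1 (f2 s),
      forall s : R, s < 0 -> is_derive s 1 f2 (f3 s),
      forall s : R, s < 0 -> {for s, continuous f3} &
      forall s : R, s < 0 -> 0 < f3 s].
Proof.
move=> [_ /(_ 1 I) [d1 [_ /(_ 1 I) [d2 [_ /(_ 1 I) [d3 [c3 _]]]]]]] fpos.
exists ('D_1 f), ('D_1 ('D_1 f)), ('D_1 ('D_1 ('D_1 f))); split=> s s0.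
- exact: derivableP (d1 s s0).
- exact: derivableP (d2 s s0).
- exact: derivableP (d3 s s0).
- move: c3; rewrite (continuous_open_subspace _ (@open_lt R 0)).
  by apply; rewrite inE.
have := fpos s s0; rewrite !derive1nS derive1n0.
have E (g : R -> R) : (g^`())%classic = 'D_1 g by apply/funext => u; exact: derive1E.
by rewrite !E.
Qed.

(** On a cube of side L at distance of order L from the origin, the density would be at least of
    order 1/L while the volume is L^3, so the integral of the absolute value would exceed every
    multiple of L. *)
Lemma shell_integrable_not_bounded_away f :
  shell_integrable m (fun p => f (-1 + dot p (delta_mx 0 0))) ->
  ~ bounded_away_at_ninfty f.
Proof.
move=> If [c [s0 [c0 s00 cf]]].
set F := (fun p => _) in If.
have Iabs : (@leb3 R).-integrable setT (EFin \o (fun k => `|shell_density m F k|)).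
  exact: integrable_abse If.
set J := Rintegral (@leb3 R) setT (fun k => `|shell_density m F k|).
have bound L : 0 < L -> - s0 <= L -> c * m / (m + 6 * L) * L ^+ 3 <= J.
  move=> L0 Ls.
  pose k := (3 * L / 2, 3 * L / 2, 3 * L / 2) : R * R * R.
  have L20 : 0 < L / 2 by rewrite divr_gt0.
  have mc := @measurable_cube R k (L / 2).
  have vol := leb3_cube k L20.
  have mL : 0 < m + 6 * L by rewrite addr_gt0// mulr_gt0.
  rewrite (_ : L ^+ 3 = fine (leb3 (cube k (L / 2)))); last first.
    by rewrite vol /=; congr (_ ^+ _); field.
  have fin : (leb3 (cube k (L / 2)) < +oo)%E by rewrite vol ltry.
  apply: Rintegral_ge_cst; [exact: mc | exact: fin | exact: Iabs | by move=> q; exact: normr_ge0 |].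
  move=> q [[/=]]; rewrite !in_itv /= => /andP[a1 a2] /andP[a3 a4] /andP[a5 a6].
  have E0 := energy_gt0 m0 q.
  have /andP[EL EU] : L <= energy m q <= m + 6 * L by exact: (energy_bounds m0 L0 E0 a1 a2 a3 a4 a5 a6 (energy_sqr m q)).
  rewrite /shell_density /F normrM (@ger0_norm _ (m / energy m q)); last by rewrite divr_ge0 ?ltW.
  rewrite -mulrA ler_pM ?divr_ge0 ?(ltW c0) ?(ltW m0) ?(ltW mL)//.
    apply: cf; rewrite dotE !mxE /=; lra.
  by rewrite ler_pM2l// lef_pV2.
(* The summands secure in turn [1 <= L], [m + 6 * L <= 7 * L], arguments of f below [s0], and
   [c * m * L] above 7 times [|J|]. *)
pose L := 1 + m + (- s0) + 7 * `|J| / (c * m).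
have cm : 0 < c * m by rewrite mulr_gt0.
have J0 : 0 <= 7 * `|J| / (c * m) by rewrite divr_ge0 ?mulr_ge0// ltW.
have L0 : 0 < L by rewrite /L; have := m0; lra.
have := bound L L0 ltac:(rewrite /L; have := m0; lra).
apply/negP; rewrite -ltNge.
have mL : 0 < m + 6 * L by rewrite addr_gt0// mulr_gt0.
have L1 : 1 <= L by rewrite /L; have := m0; lra.
rewrite mulrAC ltr_pdivlMr//.
have step1 : J * (m + 6 * L) <= `|J| * (7 * L).
  apply: le_trans (_ : `|J| * (m + 6 * L) <= _); first by rewrite ler_wpM2r ?ler_norm// ltW.
  by rewrite ler_wpM2l// /L; lra.
apply: le_lt_trans step1 _.
have : 7 * `|J| < c * m * L.
  rewrite [ltRHS]mulrC -ltr_pdivrMr// /L; have := m0; lra.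
move=> lt; rewrite mulrA (mulrC `|J|).
apply: lt_le_trans (_ : c * m * L * L <= _); first by rewrite ltr_pM2r.
rewrite -mulrA ler_pM2l// exprS ler_wpM2l ?(ltW L0)// -[leLHS]expr1 ler_weXn2l//.
Qed.

Lemma shell_integrable_cone f y :
  (forall s : R, s < 0 -> {for s, continuous f}) ->
  (forall s, s < 0 -> 0 < f s) -> (forall s t, s <= t -> t < 0 -> f s <= f t) ->
  shell_integrable m (fun p => f (y.1.1 + dot p y.1.2)) ->
  eq_state y.1 -> (forall k, dot2 (shell m k) y.2 <= 0) ->
  (@leb3 R).-integrable setT (EFin \o (fun k => f (pairing (shell m k) y) * (m / energy m k))).
Proof.
move=> cf fpos fmono Iy ey y2.
have neg k : pairing (shell m k) y < 0 by exact: pairing_lt0.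
have neg' k : y.1.1 + dot (shell m k) y.1.2 < 0.
  have := @pairing_lt0 _ m m0 k (y.1, 0) ey; rewrite /pairing /=.
  by rewrite dot20 addr0; apply.
apply: le_integrable Iy => //.
  apply/measurable_EFinP; apply: measurable_funM.
    apply: (measurable_comp (F := [set s : R | s < 0])).
    - exact: open_measurable (@open_lt R 0).
    - by move=> _ [k _ <-]; exact: neg.
    - apply: open_continuous_measurable_fun; first exact: open_lt.
      by move=> s; rewrite inE; exact: cf.
    - exact: measurable_pairing.
  apply: measurable_funM => //.
  apply: (measurable_comp (F := [set s : R | 0 < s])).
  - exact: open_measurable (@open_gt R 0).
  - by move=> _ [k _ <-]; exact: energy_gt0.
  - apply: open_continuous_measurable_fun; first exact: open_gt.
    move=> s; rewrite inE => s0; apply: inv_continuous; exact: lt0r_neq0.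
  - exact: measurable_energy.
move=> k _; rewrite /shell_density /= lee_fin !normrM ler_wpM2r//.
rewrite !gtr0_norm ?fpos//; apply: fmono => //.
by rewrite /pairing gerDl.
Qed.

End ProfileFunction.

(** * The third derivative at equilibrium *)

Lemma integrable_third_difference d (T : measurableType d) (R : realType)
    (mu : {measure set T -> \bar R}) (g0 g1 g2 g3 g4 g5 : T -> R) :
  mu.-integrable setT (EFin \o g0) -> mu.-integrable setT (EFin \o g1) ->
  mu.-integrable setT (EFin \o g2) -> mu.-integrable setT (EFin \o g3) ->
  mu.-integrable setT (EFin \o g4) -> mu.-integrable setT (EFin \o g5) ->
  let D k := (g0 k - 2 * g1 k + g2 k) - (g3 k - 2 * g4 k + g5 k) in
  mu.-integrable setT (EFin \o D) /\
  Rintegral mu setT D =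
    (Rintegral mu setT g0 - 2 * Rintegral mu setT g1 + Rintegral mu setT g2)
  - (Rintegral mu setT g3 - 2 * Rintegral mu setT g4 + Rintegral mu setT g5).
Proof.
move=> i0 i1 i2 i3 i4 i5 D.
pose K (h : T -> R) (v : R) := mu.-integrable setT (EFin \o h) /\ Rintegral mu setT h = v.
have KD h1 v1 h2 v2 : K h1 v1 -> K h2 v2 -> K (fun k => h1 k + h2 k) (v1 + v2).
  move=> [j1 <-] [j2 <-]; split; last by rewrite RintegralD.
  by rewrite (_ : EFin \o _ = (EFin \o h1) \+ (EFin \o h2))%E//; exact: integrableD.
have KB h1 v1 h2 v2 : K h1 v1 -> K h2 v2 -> K (fun k => h1 k - h2 k) (v1 - v2).
  move=> [j1 <-] [j2 <-]; split; last by rewrite RintegralB.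
  by rewrite (_ : EFin \o _ = (EFin \o h1) \- (EFin \o h2))%E//; exact: integrableB.
have KZ a h v : K h v -> K (fun k => a * h k) (a * v).
  move=> [j <-]; split; last by rewrite RintegralZl.
  exact: (integrableZl measurableT a j).
by apply: (KB); apply: (KD) => //; apply: (KB) => //; exact: KZ.
Qed.

Section IntegrandBound.
Variables (R : realType) (m : R).
Hypothesis m0 : 0 < m.
Implicit Types (k : R * R * R) (x : R * 'rV[R]_4) (y Z : dynvar R) (t : 'rV[R]_4).

Lemma continuous_lt_open (T : topologicalType) (g : T -> R) (b : R) :
  continuous g -> open [set x | g x < b] /\ open [set x | b < g x].
Proof.
move=> /continuousP cg.
by split; [exact: (cg _ (@open_lt R b)) | exact: (cg _ (@open_gt R b))].
Qed.

Lemma open_eq_state : open [set y : dynvar R | eq_state y.1].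
Proof.
have c1 y : {for y, continuous (fun y : dynvar R => y.1)} by exact: cvg_fst.
have czeta : continuous (fun y : dynvar R => y.1.1).
  by move=> y; exact: (continuous_comp (c1 y) cvg_fst).
have cvec y : {for y, continuous (fun y : dynvar R => y.1.2)}.
  exact: (continuous_comp (c1 y) cvg_snd).
have cva a : continuous (fun y : dynvar R => y.1.2 0 a).
  by move=> y; exact: (continuous_comp (cvec y) (@coord_continuous R 1 4 0 a y.1.2)).
have cdot : continuous (fun y : dynvar R => dot y.1.2 y.1.2).
  rewrite (_ : (fun _ => _) = fun y : dynvar R => - (y.1.2 0 0 * y.1.2 0 0)
    + y.1.2 0 1 * y.1.2 0 1 + y.1.2 0 2%:R * y.1.2 0 2%:R + y.1.2 0 3%:R * y.1.2 0 3%:R).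
    by move=> y; do 3![apply: cvgD; last by apply: cvgM; exact: cva];
      apply: cvgN; apply: cvgM; exact: cva.
  by apply/funext => y; exact: dotE.
have [ltz _] := continuous_lt_open 0 czeta.
have [ltd _] := continuous_lt_open 0 cdot.
have [_ gtv] := continuous_lt_open 0 (cva 0).
rewrite (_ : [set _ | _] = [set y : dynvar R | y.1.1 < 0] `&` ([set y : dynvar R | dot y.1.2 y.1.2 < 0]
   `&` [set y : dynvar R | 0 < y.1.2 0 0])) //.
by apply: openI => //; apply: openI.
Qed.

Lemma perturbation0 : @perturbation R 0.
Proof. exact: tracefree_sym0. Qed.

Lemma perturbationD y Z : perturbation y -> perturbation Z -> perturbation (y + Z).
Proof. exact: tracefree_symD. Qed.

Lemma perturbationZ (a : R) Z : perturbation Z -> perturbation (a *: Z).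
Proof. exact: tracefree_symZ. Qed.

Lemma cube_norm_le k k' (r : R) : cube k r k' -> `|k' - k| <= r.
Proof.
move=> [[/=]]; rewrite !in_itv /= => h1 h2 h3.
by rewrite !prod_normE /= !ge_max !ler_norml; apply/andP; split; [apply/andP; split|];
  apply/andP; split; lra.
Qed.

(** Joint continuity at a momentum where [Z] does not pair to 0. Uniformity in both [k'] and [y]
    matters: the mean value theorem will evaluate [f3] at a base point that varies with the
    momentum. *)
Lemma integrand_lower_bound (f3 : R -> R) x Z t :
  (forall s : R, s < 0 -> {for s, continuous f3}) -> (forall s : R, s < 0 -> 0 < f3 s) ->
  eq_state x -> perturbation Z -> Z != 0 -> future_causal t ->
  exists k e c, [/\ 0 < e, 0 < c & forall k' y, cube k e k' -> `|y - (x, 0)| <= e ->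
    c <= pairing (shell m k') Z ^+ 2 * (- dot (shell m k') t) *
         f3 (pairing (shell m k') y) * (m / energy m k')].
Proof.
move=> cf3 f3pos ex pZ Z0 ft.
have [k kZ] : exists k, pairing (shell m k) Z != 0.
  apply: contrapT => H; move/eqP : Z0; apply; apply: (pairing_shell_eq0 m0 pZ) => k.
  by apply/eqP; apply: contrapT => /negP kZ; apply: H; exists k.
pose Phi (q : (R * R * R) * dynvar R) : R := pairing (shell m q.1) Z ^+ 2 * (- pairing (shell m q.1) (0, t, 0)) *
         f3 (pairing (shell m q.1) q.2) * (m / energy m q.1).
pose q0 : (R * R * R) * dynvar R := (k, (x, 0)).
have neg : pairing (shell m q0.1) q0.2 < 0.
  by apply: (pairing_lt0 m0) => //=; rewrite dot20.
have Et k' : pairing (shell m k') (0, t, 0) = dot (shell m k') t.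
  by rewrite /pairing /= dot20 add0r addr0.
have cE : {for q0, continuous (fun q : (R * R * R) * dynvar R => energy m q.1)}.
  have c1 : {for q0, continuous (fun q : (R * R * R) * dynvar R => q.1)} by exact: cvg_fst.
  exact: (continuous_comp c1 (@continuous_energy R m q0.1)).
have cP (Y : dynvar R) : {for q0, continuous (fun q : (R * R * R) * dynvar R => pairing (shell m q.1) Y)}.
  have cc : {for q0, continuous (fun q : (R * R * R) * dynvar R => (q.1, Y))}.
    apply: (@cvg_pair _ _ _ (nbhs q0) (nbhs q0.1) (nbhs Y) _ _ _ (fun q => q.1) (fun=> Y)); [exact: cvg_fst | exact: cvg_cst].
  exact: (continuous_comp cc (@continuous_pairing R m (q0.1, Y))).
have cPhi : {for q0, continuous Phi}.
  apply: cvgM; first apply: cvgM; first apply: cvgM.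
  - exact: (continuous_comp (cP Z) (@exprn_continuous R 2 _)).
  - by apply: cvgN; exact: cP.
  - exact: (continuous_comp (@continuous_pairing R m q0) (cf3 _ neg)).
  - apply: cvgM; first exact: cvg_cst.
    by apply: cvgV => //; apply: lt0r_neq0; exact: energy_gt0.
have Phi0 : 0 < Phi q0.
  apply: mulr_gt0; first apply: mulr_gt0; first apply: mulr_gt0.
  - by rewrite exprn_even_gt0.
  - by rewrite oppr_gt0 Et; apply: dot_timelike_causal => //; exact: shell_timelike.
  - exact: f3pos.
  - by rewrite divr_gt0// energy_gt0.
have nb : nbhs q0 [set q | Phi q0 / 2 < Phi q].
  apply: (cPhi [set s | Phi q0 / 2 < s]); apply: open_nbhs_nbhs; split; first exact: open_gt.
  by rewrite /= ltr_pdivrMr// ltr_pMr// ltr1n.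
have [e e0 eP] := nbhs_norm_le nb.
exists k, e, (Phi q0 / 2); split => //; first by rewrite divr_gt0.
move=> k' y kk' yx.
have E : q0 + (k' - k, y - (x, 0)) = (k', y).
  by rewrite /q0; congr (_, _); rewrite /= addrC subrK.
have := eP (k' - k, y - (x, 0)); rewrite E prod_normE /= ge_max yx cube_norm_le// => /(_ erefl).
by rewrite [Phi (k', y)]/Phi /= Et => /ltW.
Qed.

End IntegrandBound.

Section ThirdDerivativeAtEquilibrium.
Variables (R : realType) (m : R).
Hypothesis m0 : 0 < m.
Implicit Types (k : R * R * R) (x : R * 'rV[R]_4) (y Z : dynvar R) (t : 'rV[R]_4).
(** [third_difference] on the real line, with the numbers [a] and [b] as directions: a derivative
    along [a] is [a] times the ordinary one, whatever the sign of [a], and also for [a = 0]. *)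
Lemma third_difference_profile (f f1 f2 f3 : R -> R) (p a b h : R) :
  (forall s : R, s < 0 -> is_derive s 1 f (f1 s)) ->
  (forall s : R, s < 0 -> is_derive s 1 f1 (f2 s)) ->
  (forall s : R, s < 0 -> is_derive s 1 f2 (f3 s)) -> 0 < h ->
  (forall s r, 0 <= s <= 2 * h -> 0 <= r <= h -> p + s * a + r * b < 0) ->
  exists s r, [/\ 0 <= s <= 2 * h, 0 <= r <= h &
    (f (p + 2 * h * a + h * b) - 2 * f (p + h * a + h * b) + f (p + h * b))
    - (f (p + 2 * h * a) - 2 * f (p + h * a) + f p)
    = h ^+ 3 * (a ^+ 2 * b * f3 (p + s * a + r * b))].
Proof.
move=> d1 d2 d3 h0 neg.
have dir (g dg : R -> R) (c y : R) : is_derive y 1 g (dg y) -> is_derive y c g (c * dg y).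
  by move=> dgy; have := is_deriveZdir c dgy; rewrite /GRing.scale /= mulr1.
have dirZ (g dg : R -> R) (e c y : R) : is_derive y 1 g (dg y) ->
    is_derive y c (fun u => e * g u) (e * (c * dg y)).
  by move=> /(dir _ _ c) dgy; exact: is_deriveZ.
have [|s [r [sh rh E]]] := @third_difference R R^o f (fun s => a * f1 s)
  (fun s => a * (a * f2 s)) (fun s => a * (a * (b * f3 s))) p a b h h0.
  move=> s r sh rh /=; have ny := neg s r sh rh; split.
  - by apply: dir; exact: d1.
  - by apply: dirZ; exact: d2.
  - have -> : (fun u => a * (a * f2 u)) = (fun u => (a * a) * f2 u) by apply/funext => u; rewrite mulrA.
    by rewrite mulrA; apply: dirZ; exact: d3.
exists s, r; split => //.
rewrite (_ : a ^+ 2 * b * f3 (p + s * a + r * b) = a * (a * (b * f3 (p + s * a + r * b)))) //.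
by rewrite expr2 !mulrA.
Qed.

Lemma third_derivative_lt0 (f : R -> R) (chi : dynvar R -> R) x Z t :
  Ck_on setT 3 [set x : R | x < 0] f -> equilibrium_well_defined m f ->
  manifestly_causal f -> extended_dissipative m f chi ->
  eq_state x -> perturbation Z -> Z != 0 -> future_causal t ->
  'D_(0, t, 0) ('D_Z ('D_Z chi)) (x, 0) < 0.
Proof.
have aux (u v w : R) : 0 < w -> w <= - v -> u - v <= w / 2 -> u < 0 by lra.
move=> hf [Iq _] hc [chiE [Dom [Dom_open eqO CO]]] ex pZ Z0 ft.
have [f1 [f2 [f3 [d1 d2 d3 c3 f3pos]]]] := manifestly_causal_derivatives hf hc.
have cf (s : R) : s < 0 -> {for s, continuous f}.
  move=> s0; apply: differentiable_continuous; apply/derivable1_diffP.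
  exact: (@ex_derive _ _ _ _ _ _ _ (d1 s s0)).
have nb : ~ bounded_away_at_ninfty f.
  apply: (shell_integrable_not_bounded_away m0); apply: (Iq (-1, delta_mx 0 0)).
  rewrite /eq_state /future_timelike /= dotE !mxE /=; split; lra.
have [fpos fmono] := pos_third_derivative d1 d2 d3 f3pos nb.
pose T : dynvar R := (0, t, 0).
pose x0 : dynvar R := (x, 0).
(* The conditions on the scalar and the vector are open and those on the tensor linear; regrouping
   them puts the domain in the form of an open set intersected with a subspace. *)
pose N := Dom `&` [set y : dynvar R | eq_state y.1].
have oN : open N by apply: openI; [exact: Dom_open | exact: open_eq_state].
have UE : Dom `&` @state R = N `&` @perturbation R.
  by apply/seteqP; split => y; [move=> [Dy [ey py]] | move=> [[Dy ey] py]].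
rewrite UE in CO.
have Ux0 : (N `&` @perturbation R) x0.
  by split; [split => //; exact: eqO | exact: perturbation0].
have pT : perturbation T by exact: perturbation0.
have CZ := Ck_on_derive CO pZ; have CZZ := Ck_on_derive CZ pZ.
have CT := Ck_on_derive CZZ pT.
have [k1 [e [c [e0 c0 lower_bound]]]] := integrand_lower_bound m0 c3 f3pos ex pZ Z0 ft.
(* Fixed before the step [h]: both sides of the integral estimate carry [h ^+ 3], so the third
   derivative is at most [- v] at an intermediate point, and [h] is then taken small enough that it
   changes by at most [v / 2] back to equilibrium. *)
pose v := c * fine (leb3 (cube k1 e)).
have v0 : 0 < v by rewrite /v leb3_cube//= mulr_gt0// exprn_gt0// mulr_gt0.
have [B [nB BU]] : exists B, nbhs x0 B /\ forall y, B y -> (N `&` @perturbation R) y ->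
    `|'D_T ('D_Z ('D_Z chi)) x0 - 'D_T ('D_Z ('D_Z chi)) y| <= v / 2.
  have v20 : 0 < v / 2 by rewrite divr_gt0.
  move/subspace_continuousP : (Ck_on_continuous CT) => /(_ x0 Ux0) /cvgrPdist_le /(_ _ v20).
  by rewrite near_withinE => nA; eexists; split; [exact: nA|].
have [e1 e10 eN] := nbhs_norm_le (open_nbhs_nbhs (conj oN Ux0.1)).
have [e2 e20 eB] := nbhs_norm_le nB.
(* Scaled by the size of the tensor part of [Z] so that [h *: A] absorbs up to [2 * h] of [Z];
   moving along [T] leaves the tensor part unchanged. *)
pose A : dynvar R := (0, 0, mx_sum_norm Z.2 *: cone_axis R).
have pA : perturbation A by apply: tracefree_symZ; exact: tracefree_sym_cone_axis.
pose P (h s r : R) := x0 + h *: A + s *: Z + r *: T.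
have [h h0 hP] : exists2 h, 0 < h & forall s r, 0 <= s <= 2 * h -> 0 <= r <= h ->
    [/\ `|P h s r - x0| <= e, N (P h s r) & B (P h s r)].
  pose M := 1 + `|A| + 2 * `|Z| + `|T|.
  have M0 : 0 < M by rewrite /M -!addrA ltr_pwDl// !addr_ge0// mulr_ge0.
  pose dl := Num.min e (Num.min e1 e2).
  have dl0 : 0 < dl by rewrite !lt_min e0 e10 e20.
  have [h h0 hM] : exists2 h, 0 < h & h * M = dl.
    by exists (dl / M); [rewrite divr_gt0 | rewrite divfK// gt_eqF].
  exists h => // s r /andP[s0 sh] /andP[r0 rh].
  have E : P h s r = x0 + (h *: A + s *: Z + r *: T) by rewrite /P !addrA.
  have nz : `|h *: A + s *: Z + r *: T| <= dl.
    rewrite (le_trans (ler_normD _ _))//.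
    apply: le_trans (_ : `|h *: A| + `|s *: Z| + `|r *: T| <= _).
      by rewrite lerD2r ler_normD.
    rewrite !normrZ !ger0_norm// ?(ltW h0)//.
    apply: le_trans (_ : h * `|A| + 2 * h * `|Z| + h * `|T| <= _).
      by apply: lerD; [apply: lerD => //|]; apply: ler_wpM2r.
    rewrite -hM /M !mulrDr mulr1 -!addrA ler_wpDl ?(ltW h0)// lerD2l lerD2r.
    by rewrite [2 * h]mulrC mulrA.
  move: nz; rewrite !le_min => /andP[n1 /andP[n2 n3]].
  by rewrite E; split; [rewrite addrC addKr | exact: eN | exact: eB].
have PW s r : perturbation (P h s r).
  by do 3![apply: perturbationD; last exact: perturbationZ]; exact: perturbation0.
have PU s r : 0 <= s <= 2 * h -> 0 <= r <= h -> (N `&` @perturbation R) (P h s r).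
  by move=> sh rh; have [_ NP _] := hP s r sh rh.
have P2 s r : (P h s r).2 = (h * mx_sum_norm Z.2) *: cone_axis R + s *: Z.2.
  by rewrite /P /= scaler0 addr0 add0r scalerA.
have cone s r k : 0 <= s <= 2 * h -> dot2 (shell m k) (P h s r).2 <= 0.
  move=> sh; rewrite P2; apply: dot2_shifted_le0 => //.
  by have [/ltW] := shell_timelike m0 k.
pose g y k := f (pairing (shell m k) y) * (m / energy m k).
have Pchi s r : 0 <= s <= 2 * h -> 0 <= r <= h ->
    chi (P h s r) = Rintegral (@leb3 R) setT (g (P h s r)) /\
    (@leb3 R).-integrable setT (EFin \o g (P h s r)).
  move=> sh rh; have [[DP eP] pP] := PU s r sh rh; split.
    by apply: chiE; [split | rewrite P2; apply: Cminus_shifted].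
  by apply: shell_integrable_cone => //; [exact: Iq | move=> k; exact: cone].
have neg k s r : 0 <= s <= 2 * h -> 0 <= r <= h -> pairing (shell m k) (P h s r) < 0.
  move=> sh rh; have [[DP eP] pP] := PU s r sh rh.
  by apply: (pairing_lt0 m0) => //; exact: cone.
have [|s [r [sh rh chi3]]] := @third_difference _ _ chi ('D_Z chi) ('D_Z ('D_Z chi))
    ('D_T ('D_Z ('D_Z chi))) (x0 + h *: A) Z T h h0.
  move=> s r sh rh /=; have Up := PU s r sh rh; split; apply/derivableP.
  - exact: Ck_on_derivable CO pZ Up.
  - exact: Ck_on_derivable CZ pZ Up.
  - exact: Ck_on_derivable CZZ pT Up.
have z2 : 0 <= (0 : R) <= 2 * h by rewrite lexx mulr_ge0// ltW.
have hh2 : 0 <= 2 * h <= 2 * h by rewrite lexx mulr_ge0// ltW.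
have h2 : 0 <= h <= 2 * h by rewrite (ltW h0) ler_peMl ?(ltW h0)// ler1n.
have zh : 0 <= (0 : R) <= h by rewrite lexx ltW.
have hh : 0 <= h <= h by rewrite lexx ltW.
have q0 : P h (2 * h) h = x0 + h *: A + (2 * h) *: Z + h *: T by [].
have q1 : P h h h = x0 + h *: A + h *: Z + h *: T by [].
have q2 : P h 0 h = x0 + h *: A + h *: T by rewrite /P scale0r addr0.
have q3 : P h (2 * h) 0 = x0 + h *: A + (2 * h) *: Z by rewrite /P scale0r addr0.
have q4 : P h h 0 = x0 + h *: A + h *: Z by rewrite /P scale0r addr0.
have q5 : P h 0 0 = x0 + h *: A by rewrite /P !scale0r !addr0.
have [c0' i0] := Pchi _ _ hh2 hh; have [c1' i1] := Pchi _ _ h2 hh.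
have [c2' i2] := Pchi _ _ z2 hh; have [c3' i3] := Pchi _ _ hh2 zh.
have [c4' i4] := Pchi _ _ h2 zh; have [c5' i5] := Pchi _ _ z2 zh.
have [iD ED] := integrable_third_difference i0 i1 i2 i3 i4 i5.
set D := (fun k => _) in iD ED.
have chiD : h ^+ 3 * 'D_T ('D_Z ('D_Z chi)) (P h s r) = Rintegral (@leb3 R) setT D.
  by rewrite -chi3 -q0 -q1 -q2 -q3 -q4 -q5 c0' c1' c2' c3' c4' c5' -ED.
have Pk k s' r' : pairing (shell m k) (P h s' r') =
    pairing (shell m k) (P h 0 0) + s' * pairing (shell m k) Z + r' * dot (shell m k) t.
  have ET : pairing (shell m k) T = dot (shell m k) t.
    by rewrite /pairing /= dot20 add0r addr0.
  by rewrite q5 /P pairingD (pairingD _ (x0 + h *: A)) !pairingZ ET.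
clearbody P.
(* The intermediate parameters vary with [k]. Only [D] is integrated; this expression supplies its
   sign everywhere and its lower bound on the cube. *)
have Dk k : exists s' r', [/\ 0 <= s' <= 2 * h, 0 <= r' <= h &
    D k = - (h ^+ 3 * (pairing (shell m k) Z ^+ 2 * (- dot (shell m k) t) *
      f3 (pairing (shell m k) (P h s' r')) * (m / energy m k)))].
  have [|s' [r' [sh' rh' E]]] := third_difference_profile (p := pairing (shell m k) (P h 0 0))
    (a := pairing (shell m k) Z) (b := dot (shell m k) t) d1 d2 d3 h0.
    by move=> s' r' sh' rh'; rewrite -Pk; exact: neg.
  exists s', r'; split => //.
  have -> : D k = ((f (pairing (shell m k) (P h (2 * h) h)) - 2 * f (pairing (shell m k) (P h h h))
      + f (pairing (shell m k) (P h 0 h))) - (f (pairing (shell m k) (P h (2 * h) 0))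
      - 2 * f (pairing (shell m k) (P h h 0)) + f (pairing (shell m k) (P h 0 0)))) * (m / energy m k).
    by rewrite /D /g; ring.
  rewrite !(Pk _ (2 * h)) !(Pk _ h) (Pk _ 0 h) !mul0r !addr0 E -Pk; ring.
have h30 : 0 < h ^+ 3 by rewrite exprn_gt0.
have vol : (leb3 (cube k1 e) < +oo)%E by rewrite leb3_cube// ltry.
have : h ^+ 3 * c * fine (leb3 (cube k1 e)) <= Rintegral (@leb3 R) setT (fun k => -1 * D k).
  apply: Rintegral_ge_cst; [exact: measurable_cube|exact: vol|exact: (integrableZl measurableT (-1) iD)| |].
    move=> k; have [s' [r' [sh' rh' ->]]] := Dk k.
    rewrite mulN1r opprK; apply: mulr_ge0; first exact: ltW.
    apply: mulr_ge0; last by rewrite divr_ge0 ?ltW// energy_gt0.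
    apply: mulr_ge0; last by apply/ltW/f3pos/neg.
    apply: mulr_ge0; first exact: sqr_ge0.
    by rewrite oppr_ge0 ltW// dot_timelike_causal//; exact: shell_timelike.
  move=> k kc; have [s' [r' [sh' rh' ->]]] := Dk k.
  have [Pe _ _] := hP s' r' sh' rh'.
  by rewrite mulN1r opprK ler_pM2l//; exact: lower_bound.
rewrite RintegralZl// mulN1r -chiD -mulrA -mulrN ler_pM2l// -/v => vle.
have [_ _ BP] := hP s r sh rh.
exact: aux v0 vle (le_trans (ler_norm _) (BU _ BP (PU s r sh rh))).
Qed.

End ThirdDerivativeAtEquilibrium.

(** * Uniformity in the perturbation *)

Section PerturbationFrame.
Variable R : realType.
Implicit Types (S : 'M[R]_4) (Z : dynvar R).

Lemma trace_etaE S :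
  \sum_a \sum_b eta R a b * S a b = - S 0 0 + S 1 1 + S 2%:R 2%:R + S 3%:R 3%:R.
Proof. by rewrite !sum4 !mxE /=; ring. Qed.

(** The linear projection onto symmetric trace-free matrices; the factor 1/4 appears because [eta]
    contracted with itself is 4. *)
Definition tracefree_part S : 'M[R]_4 :=
  2^-1 *: (S + S^T) - (4^-1 * \sum_a \sum_b eta R a b * S a b) *: eta R.

Lemma tracefree_partD S S' : tracefree_part (S + S') = tracefree_part S + tracefree_part S'.
Proof.
rewrite /tracefree_part !trace_etaE; apply/matrixP => a b; rewrite !mxE /=; ring.
Qed.

Lemma tracefree_partZ (s : R) S : tracefree_part (s *: S) = s *: tracefree_part S.
Proof.
rewrite /tracefree_part !trace_etaE; apply/matrixP => a b; rewrite !mxE /=; ring.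
Qed.

Lemma tracefree_part_sym S : tracefree_sym (tracefree_part S).
Proof.
split.
  apply/matrixP => a b; rewrite !mxE [b == a]eq_sym [S b a + _]addrC.
  by case: eqP => [->|].
by rewrite trace_etaE /tracefree_part trace_etaE !mxE /=; field.
Qed.

Lemma tracefree_part_id S : tracefree_sym S -> tracefree_part S = S.
Proof.
move=> [sS tS]; rewrite /tracefree_part tS mulr0 scale0r subr0 sS.
by apply/matrixP => a b; rewrite !mxE; field.
Qed.

(** Matrix units are projected by [tracefree_part], which yields 21 vectors spanning a space of
    dimension 14. They are not independent, but the coordinates [c] are a linear choice, which is
    what homogeneity and compactness require. *)
Lemma perturbation_frame : exists (n : nat) (c : 'I_n -> dynvar R -> R) (B : 'I_n -> dynvar R),
  [/\ forall i, perturbation (B i),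
      forall i u v, c i (u + v) = c i u + c i v,
      forall i (a : R) u, c i (a *: u) = a * c i u
    & forall Z, perturbation Z -> Z = \sum_i c i Z *: B i].
Proof.
pose I : finType := ('I_1 + 'I_4 + ('I_4 * 'I_4))%type.
pose c (i : I) (Z : dynvar R) : R := match i with
  | inl (inl _) => Z.1.1 | inl (inr a) => Z.1.2 0 a | inr ab => Z.2 ab.1 ab.2 end.
pose B (i : I) : dynvar R := match i with
  | inl (inl _) => (1, 0, 0) | inl (inr a) => (0, delta_mx 0 a, 0)
  | inr ab => (0, 0, tracefree_part (delta_mx ab.1 ab.2)) end.
exists #|I|, (fun i => c (enum_val i)), (fun i => B (enum_val i)); split.
- move=> i; case: (enum_val i) => [[i1|a]|ab]; rewrite /perturbation /=;
    [exact: tracefree_sym0 | exact: tracefree_sym0 | exact: tracefree_part_sym].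
- by move=> i u v; case: (enum_val i) => [[i1|a]|ab]; rewrite /c /= ?mxE.
- by move=> i a u; case: (enum_val i) => [[i1|b]|ab]; rewrite /c /= ?mxE.
case=> [[z v] S]; rewrite /perturbation /= => tS.
transitivity (\sum_(i : I) c i (z, v, S) *: B i); last first.
  by rewrite (reindex (enum_val : 'I_#|I| -> I))//; exact: onW_bij (enum_val_bij I).
rewrite !big_sumType /= big_ord1 /c /B /=.
have -> : \sum_(a < 4) v 0 a *: ((0, delta_mx 0 a, 0) : dynvar R) = (0, v, 0).
  rewrite [in RHS](row_sum_delta v).
  rewrite (big_morph (fun u => (0, u, 0) : dynvar R) (id1 := 0) (op1 := +%R)) //; last first.
    by move=> u w; congr (_, _, _); rewrite /= addr0.
  by apply: eq_bigr => a _; congr (_, _, _); rewrite /= ?mulr0 ?scaler0.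
have -> : \sum_(ab : 'I_4 * 'I_4) S ab.1 ab.2 *:
    ((0, 0, tracefree_part (delta_mx ab.1 ab.2)) : dynvar R) = (0, 0, S).
  rewrite -[in RHS](tracefree_part_id tS) [in RHS](matrix_sum_delta S).
  rewrite pair_bigA /=.
  rewrite (big_morph (fun u => (0, 0, tracefree_part u) : dynvar R) (id1 := 0) (op1 := +%R)).
  - by apply: eq_bigr => ab _; congr (_, _, _); rewrite /= ?mulr0 ?scaler0 // tracefree_partZ.
  - by move=> u w; congr (_, _, _); rewrite /= ?addr0 // tracefree_partD.
  - by rewrite -{1}(scale0r (0 : 'M[R]_4)) tracefree_partZ scale0r.
by congr (_, _, _); rewrite /= ?scaler0 ?addr0 ?add0r //; rewrite [_ *: _]mulr1.
Qed.

End PerturbationFrame.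

Section Uniformity.
Variables (R : realType).
Implicit Types (v : 'rV[R]_4) (y Z : dynvar R).

Lemma lower_lower_dot t v : dot t (lower v) = \sum_a t 0 a * v 0 a.
Proof. by rewrite dotE !lowerE sum4 /= mulrN opprK. Qed.

(** Turns the condition into strict polynomial inequalities, which persist under small changes. The
    free positive factor absorbs both the 1/2 in the definition of causality and the normalisation
    of the perturbation. *)
Lemma future_timelike_lower v (s : R) : 0 < s ->
  future_timelike (s *: lower v) <->
  v 0 0 < 0 /\ v 0 1 ^+ 2 + v 0 2%:R ^+ 2 + v 0 3%:R ^+ 2 < v 0 0 ^+ 2.
Proof.
move=> s0; have sc (u : 'rV[R]_4) i : (s *: u) 0 i = s * u 0 i by rewrite mxE.
have E : dot (s *: lower v) (s *: lower v) = s ^+ 2 *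
    (v 0 1 ^+ 2 + v 0 2%:R ^+ 2 + v 0 3%:R ^+ 2 - v 0 0 ^+ 2).
  by rewrite dotE !sc !lowerE /=; ring.
rewrite /future_timelike E sc lowerE /= pmulr_rgt0// oppr_gt0.
by rewrite pmulr_rlt0 ?exprn_gt0// subr_lt0; split => -[].
Qed.

(** Meant for the projection that sends a coefficient vector to the chosen coordinates of the
    perturbation it represents: its fixed vectors are the genuine coordinates, and among them a unit
    vector cannot represent 0. *)
Lemma unit_sphere_fixed_compact n (M : 'M[R]_n) :
  compact [set w : 'rV[R]_n | `|w| = 1 /\ w *m M = w].
Proof.
apply: bounded_closed_compact.
  by exists 1; split => [|b b1 w [w1 _]]; [exact: num_real | rewrite /= w1 ltW].
(* A nonnegative continuous function vanishing exactly on the set, which is thereby closed. *)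
pose G (w : 'rV[R]_n) : R := `| `|w| - 1 | + \sum_i `|\sum_j w 0 j * M j i - w 0 i|.
have cG : continuous G.
  move=> w; pose C (g : 'rV[R]_n -> R) := {for w, continuous g}.
  have cN g : C g -> C (fun u => `|g u|).
    by move=> cg; exact: (continuous_comp cg (@norm_continuous R R^o (g w))).
  have cB g h : C g -> C h -> C (fun u => g u - h u) by move=> cg ch; exact: (cvgB cg ch).
  have cD g h : C g -> C h -> C (fun u => g u + h u) by move=> cg ch; exact: (cvgD cg ch).
  have cS g : (forall i : 'I_n, C (g i)) -> C (fun u => \sum_i g i u) by exact: continuous_for_sum.
  have cc i : C (fun u => u 0 i) by exact: coord_continuous.
  have ck (a : R) : C (fun=> a) by exact: (@cst_continuous _ _ a w).
  apply: (cD).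
    by apply: (cN); apply: (cB) => //; exact: norm_continuous.
  apply: (cS) => i; apply: (cN); apply: (cB) => //; apply: (cS) => j.
  exact: (cvgM (cc j) (ck _)).
rewrite (_ : mkset _ = G @^-1` [set x | x <= 0]).
  by move/continuous_closedP : cG; apply; exact: closed_le.
apply/seteqP; split => w /=.
  move=> [w1 wM]; rewrite /G w1 subrr normr0 add0r big1 // => i _.
  by rewrite -[w in X in _ - X]wM mxE subrr normr0.
move=> G0; have S0 : 0 <= \sum_i `|\sum_j w 0 j * M j i - w 0 i| by exact: sumr_ge0.
have [E1 E2] : `| `|w| - 1 | = 0 /\ \sum_i `|\sum_j w 0 j * M j i - w 0 i| = 0.
  by move: G0 (normr_ge0 (`|w| - 1)) S0; rewrite /G; split; lra.
split; first by apply/eqP; rewrite -subr_eq0 -normr_eq0 E1.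
apply/rowP => i; rewrite mxE; apply/eqP; rewrite -subr_eq0 -normr_eq0.
move/eqP : E2; rewrite psumr_eq0 // => /allP /(_ i).
by rewrite mem_index_enum => /(_ isT).
Qed.

End Uniformity.

(** * Causality in a neighbourhood of equilibrium *)

Unset Implicit Arguments.

Theorem theorem1 (R : realType) (m : R) (hm : 0 < m) (f : R -> R)
    (hf : Ck_on setT 3 [set x : R | x < 0] f)
    (heq : equilibrium_well_defined m f)
    (hcausal : manifestly_causal f)
    (chi : dynvar R -> R)
    (hchi : extended_dissipative m f chi)
    (x : R * 'rV[R]_4) (hx : eq_state x) :
  \forall y \near (x, 0 : 'M[R]_4), state y -> causal_at chi y.
Proof.
have [chiE [Dom [Dom_open eqDom CU]]] := hchi.
pose x0 : dynvar R := (x, 0).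
pose N := Dom `&` [set y : dynvar R | eq_state y.1].
have oN : open N by apply: openI; [exact: Dom_open | exact: open_eq_state].
pose W := @perturbation R.
have UE : Dom `&` @state R = N `&` W.
  by apply/seteqP; split => y; [move=> [Dy [ey py]] | move=> [[Dy ey] py]].
rewrite UE in CU.
have W0 : W 0 := @perturbation0 R; have WD := @perturbationD R; have WZ := @perturbationZ R.
have Ux0 : (N `&` W) x0 by split; [split => //; exact: eqDom | exact: W0].
have [n [c [B [BW cD cZ Zexp]]]] := perturbation_frame R.
have dW a : W (d_vec R a) by exact: tracefree_sym0.
pose C a i j := 'D_(d_vec R a) ('D_(B i) ('D_(B j) chi)).
pose rho y (w : 'rV[R]_n) a : R := \sum_i \sum_j w 0 i * w 0 j * C a i j y.
have CB i := Ck_on_derive CU (BW i).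
have CBB i j := Ck_on_derive (CB j) (BW i).
have rhoE y (w : 'rV[R]_n) a : (N `&` W) y -> let Z := \sum_i w 0 i *: B i in
    'D_(d_vec R a) ('D_Z ('D_Z chi)) y = rho y w a.
  by move=> Uy Z; exact: (derive3_expand W0 WD WZ oN _ CU Uy (dW a) BW).
have c_sum i (w : 'rV[R]_n) : c i (\sum_j w 0 j *: B j) = \sum_j w 0 j * c i (B j).
  have c0 : c i 0 = 0 by rewrite -(scale0r (0 : dynvar R)) cZ mul0r.
  by rewrite (big_morph (c i) (cD i) c0); apply: eq_bigr => j _; rewrite cZ.
(* [w *m M] lists the coordinates of the perturbation with coefficients [w], so [w *m M = w] says
   that [w] already consists of those coordinates. *)
pose M : 'M[R]_n := \matrix_(j, i) c i (B j).
pose K := [set w : 'rV[R]_n | `|w| = 1 /\ w *m M = w].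
have cK i (w : 'rV[R]_n) : w *m M = w -> c i (\sum_j w 0 j *: B j) = w 0 i.
  by move=> wM; rewrite c_sum -[in RHS]wM mxE; apply: eq_bigr => j _; rewrite mxE.
pose cone y w := rho y w 0 < 0 /\
  rho y w 1 ^+ 2 + rho y w 2%:R ^+ 2 + rho y w 3%:R ^+ 2 < rho y w 0 ^+ 2.
have cone0 w : K w -> cone x0 w.
  move=> [w1 wM]; set Z := \sum_j w 0 j *: B j.
  have WZ' : W Z by exact: (W_sum W0 WD WZ).
  have Z0 : Z != 0.
    apply/eqP => Ze; suff we : w = 0 by move: w1; rewrite we normr0 => /eqP; rewrite eq_sym oner_eq0.
    apply/rowP => i; rewrite mxE -(cK i w wM) -/Z Ze.
    by rewrite -(scale0r (0 : dynvar R)) cZ mul0r.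
  have CZ := Ck_on_derive CU WZ'; have CZZ := Ck_on_derive CZ WZ'.
  have : future_timelike (lower (\row_a rho x0 w a)).
    apply: future_timelike_dual => t ft.
    have := third_derivative_lt0 hm hf heq hcausal hchi hx WZ' Z0 ft.
    have -> : ((0, t, 0) : dynvar R) = \sum_a t 0 a *: d_vec R a.
      rewrite [in LHS](row_sum_delta t).
      rewrite (big_morph (fun u => (0, u, 0) : dynvar R) (id1 := 0) (op1 := +%R)) //; last first.
        by move=> u v; congr (_, _, _); rewrite /= addr0.
      by apply: eq_bigr => a _; congr (_, _, _); rewrite /= ?mulr0 ?scaler0.
    rewrite (derive_dir_sum W0 WD WZ oN _ CZZ Ux0 dW) lower_lower_dot.
    by under eq_bigr do rewrite rhoE//; under [X in _ -> X < 0]eq_bigr do rewrite mxE.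
  rewrite -[lower _]scale1r => /(future_timelike_lower _ ltr01).
  by rewrite !mxE.
(* The coefficients [C] are continuous only relative to the states, so the covering argument for [K]
   runs along this relative filter; its conclusion, restricted to states, is what the theorem
   asks. *)
pose F := within (N `&` W) (nbhs x0).
have near_cone : \forall y \near F, K `<=` cone y.
  have /compact_near_coveringP cover : compact K by exact: unit_sphere_fixed_compact.
  apply: (cover _ F cone).
  move=> w0 Kw0; have [lt1 lt2] := cone0 w0 Kw0.
  pose G := filter_prod (nbhs w0) F.
  have cG1 : p.1 @[p --> G] --> w0 by exact: cvg_fst.
  have cG2 : p.2 @[p --> G] --> F by exact: cvg_snd.
  have cw i : (fun p : 'rV[R]_n * dynvar R => p.1 0 i) @ G --> w0 0 i.
    exact: (cvg_comp (fun p : 'rV[R]_n * dynvar R => p.1) (fun u : 'rV[R]_n => u 0 i) cG1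
      (@coord_continuous R 1 n 0 i w0)).
  have crho a : rho p.2 p.1 a @[p --> G] --> rho x0 w0 a.
    apply: cvg_finite_sum => i; apply: cvg_finite_sum => j; apply: cvgM; first apply: cvgM.
    - exact: (cw i).
    - exact: (cw j).
    - have CC : C a i j @ F --> C a i j x0.
        move/subspace_continuousP : (Ck_on_continuous (Ck_on_derive (CBB i j) (dW a))).
        by apply.
      exact: (cvg_comp (fun p : 'rV[R]_n * dynvar R => p.2) (C a i j) cG2 CC).
  have near1 : \forall p \near G, rho p.2 p.1 0 < 0 by exact: (cvgr_lt (rho x0 w0 0) (crho 0)).
  have sq a : rho p.2 p.1 a ^+ 2 @[p --> G] --> rho x0 w0 a ^+ 2.
    by under eq_fun do rewrite expr2; rewrite expr2; exact: (cvgM (crho a) (crho a)).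
  have near2 : \forall p \near G, rho p.2 p.1 1 ^+ 2 + rho p.2 p.1 2%:R ^+ 2
      + rho p.2 p.1 3%:R ^+ 2 - rho p.2 p.1 0 ^+ 2 < 0.
    apply: (cvgr_lt _ (cvgB (cvgD (cvgD (sq 1) (sq 2%:R)) (sq 3%:R)) (sq 0))).
    by rewrite subr_lt0.
  suff : G [set p | cone p.2 p.1] by [].
  apply: filterS (filterI near1 near2) => p [lt1' lt2'].
  by split; [exact: lt1' | move: lt2'; rewrite subr_lt0].
move: near_cone; rewrite near_withinE => near_cone.
have near_Dom : \forall y \near x0, Dom y by apply: open_nbhs_nbhs; split => //; exact: eqDom.
apply: filterS2 near_cone near_Dom => y Ky Dy [ey py] Z pZ Z0.
have Uy : (N `&` W) y by split.
pose w : 'rV[R]_n := \row_i c i Z.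
have Zw : Z = \sum_i w 0 i *: B i.
  by rewrite {1}(Zexp Z pZ); apply: eq_bigr => i _; rewrite mxE.
have w0 : w != 0.
  apply: contra_neq Z0 => we; rewrite Zw we big1 // => i _.
  by rewrite mxE scale0r.
have nw0 : 0 < `|w| by rewrite normr_gt0.
(* The third derivative is quadratic in the perturbation, so normalising the coordinates costs only
   the positive factor [|w| ^+ 2]. *)
pose w' := `|w|^-1 *: w.
have Kw' : K w'.
  split; first by rewrite normrZ ger0_norm ?invr_ge0// mulVf// gt_eqF.
  rewrite /w' -scalemxAl; congr (_ *: _); apply/rowP => i.
  rewrite mxE [RHS]mxE [in RHS]Zw c_sum; apply: eq_bigr => j _; congr (_ * _); by rewrite mxE.
have ww' : w = `|w| *: w' by rewrite scalerA divff ?scale1r// gt_eqF.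
have wi i : w 0 i = `|w| * w' 0 i by rewrite {1}ww' mxE.
have rhoZ a : rho y w a = `|w| ^+ 2 * rho y w' a.
  rewrite /rho mulr_sumr; apply: eq_bigr => i _.
  by rewrite mulr_sumr; apply: eq_bigr => j _; rewrite !wi; ring.
have -> : Mform chi y Z Z = `|w| ^+ 2 *: lower (\row_a rho y w' a).
  rewrite /Mform /lower scalemxAl; congr (_ *m _); apply/rowP => a.
  by rewrite [LHS]mxE [RHS]mxE [in RHS]mxE -rhoZ {1 2}Zw rhoE.
rewrite scalerA; apply/future_timelike_lower; first by rewrite mulr_gt0 ?invr_gt0// exprn_gt0.
by rewrite !mxE; exact: Ky.
Qed.
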